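(* Let $\mathfrak s$ be a finite-dimensional Lie algebra over $\mathbb K\in\{\mathbb R,\mathbb C\}$, $\pi_1$ its Lie–Poisson bivector, $E$ the Euler vector field on $\mathfrak s^*$, and let $x\in\mathfrak s$ be regarded as a linear function on $\mathfrak s^*$. Then the quadratic vector field $X:=xE$ and the quadratic polynomial $q:=x^2/2$ satisfy, with $\pi=[X,\pi_1]$, the identities $$[\pi,\pi]=2\,\pi_1(q)\wedge\pi_1,\qquad [\pi,\pi_1(q)]=0.$$ Consequently, when $\mathfrak s$ is semisimple, the bivector $$\pi_2=[X,\pi_1]-\pi_1(q)\wedge\frac{\partial}{\partial x_0}+x_0\pi_1=(x_0-x)\pi_1-\pi_1(x)\wedge\Big(E+x\frac{\partial}{\partial x_0}\Big)$$ is a centrally linearizable quadratic Poisson bivector on $\mathfrak g^*=(\mathfrak s\oplus\mathbb K)^*$.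
   Context: $[\cdot,\cdot]$ is the Schouten bracket, normalized by $[X,f]=Xf$, $[X,Y]$ the Lie bracket for vector fields, $[P,Q]=-(-1)^{(p-1)(q-1)}[Q,P]$, $[P,Q\wedge R]=[P,Q]\wedge R+(-1)^{(p-1)q}Q\wedge[P,R]$ for $P,Q$ of degrees $p,q$. For a bivector $\eta$ and a function $f$, $\eta(f):=[\eta,f]$ (contraction of $\eta$ with $df$ over the second index). $\eta$ is Poisson if $[\eta,\eta]=0$. The Lie–Poisson bivector satisfies $\{y,z\}_{\pi_1}=[y,z]$ for $y,z\in\mathfrak s$. In linear coordinates $x_1,\dots,x_n$ on $\mathfrak s^*$, $E=\sum_{i=1}^nx_i\frac{\partial}{\partial x_i}$. On $\mathfrak g^*=\mathfrak s^*\oplus\mathbb K^*$ ($\mathbb K^*$ the dual line), $x_0$ is a nonzero linear coordinate vanishing on $\mathfrak s^*$; objects on $\mathfrak s^*$ are treated as objects on $\mathfrak g^*$ not depending on $x_0$ and without $\partial/\partial x_0$ component, and $\pi_1$ is then also the Lie–Poisson bivector of $\mathfrak g$. A quadratic (i.e. with homogeneous quadratic coefficients) Poisson bivector $\pi_2$ on $\mathfrak g^*$ is centrally linearizable if there is $a\in\mathbb K^*\subset\mathfrak g^*$, $a\ne0$, with $\pi_2(a)=0$ and with $[T_a,\pi_2]=\pi_1$, where $T_a$ is the constant vector field with value $a$. *)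

(* Defs.v *)
From HB Require Import structures.
From mathcomp Require Import all_boot all_order all_algebra.
From mathcomp Require Export mpoly.
Set Implicit Arguments.
Unset Strict Implicit.
Unset Printing Implicit Defensive.
Import GRing.Theory.
Local Open Scope ring_scope.

(** [ext R n] is the exterior algebra of R^n: [P S] is the coefficient of [e_{i_1} /\ ... /\ e_{i_k}] in [P], where
  [S = {i_1 < ... < i_k}]; elements may be inhomogeneous.  The
  alias hides the pointwise product of finite functions. *)

Definition ext (R : comNzRingType) (n : nat) := {ffun {set 'I_n} -> R^o}.
HB.instance Definition _ (R : comNzRingType) (n : nat) :=
  GRing.Lmodule.on (ext R n).

Section Exterior.
Variables (R : comNzRingType) (n : nat).
Implicit Types (A B S : {set 'I_n}) (P Q : ext R n).

Definition ninv A B : nat := \sum_(a in A) \sum_(b in B) (b < a)%N.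

Definition ebase A : ext R n := [ffun S : {set 'I_n} => (S == A)%:R].

Definition of_fun (f : R) : ext R n :=
  [ffun S : {set 'I_n} => if S == set0 then f else 0].

Definition wedge P Q : ext R n :=
  [ffun S : {set 'I_n} => \sum_(A : {set 'I_n} | A \subset S)
     (-1) ^+ ninv A (S :\: A) * (P A * Q (S :\: A))].

(** Left and right derivative with respect to the odd variable [e_i]: move
    [e_i] to the far left, resp. far right, of each monomial and drop it. *)
Definition lcontr (i : 'I_n) P : ext R n :=
  [ffun S : {set 'I_n} => if i \in S then 0 else (-1) ^+ ninv [set i] S * P (i |: S)].
Definition rcontr (i : 'I_n) P : ext R n :=
  [ffun S : {set 'I_n} => if i \in S then 0 else (-1) ^+ ninv S [set i] * P (i |: S)].

Definition is_mv (p : nat) P := forall S, #|S| != p -> P S = 0.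

End Exterior.

Definition mvf (K : fieldType) (n : nat) := ext {mpoly K[n]} n.
HB.instance Definition _ (K : fieldType) (n : nat) :=
  GRing.Lmodule.on (mvf K n).

Section Multivectors.
Variables (K : fieldType) (n : nat).
Implicit Types (P Q : mvf K n) (f g : {mpoly K[n]}).

Definition partial (i : 'I_n) : mvf K n := ebase _ [set i].

Definition dcoef (i : 'I_n) P : mvf K n := [ffun S : {set 'I_n} => (P S)^`M(i)].

(** The Schouten bracket, in coordinates
      [P,Q] = sum_i (P <-d/de_i) /\ dQ/dx_i - dP/dx_i /\ (d/de_i-> Q).
    It is the bracket characterized by [X,f] = X f, [X,Y] the Lie bracket,
    [P,Q] = - (-1)^((p-1)(q-1)) [Q,P] and
    [P, Q /\ R] = [P,Q] /\ R + (-1)^((p-1)q) Q /\ [P,R]: see [schouten_fun],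
    [schouten_lie], [schouten_anti] and [schouten_wedge]. *)
Definition schouten P Q : mvf K n :=
  \sum_(i < n) (wedge (rcontr i P) (dcoef i Q) - wedge (dcoef i P) (lcontr i Q)).

Definition ham (eta : mvf K n) f : mvf K n := schouten eta (of_fun n f).

Definition poisson (eta : mvf K n) := is_mv 2 eta /\ schouten eta eta = 0.

Definition quadratic P := forall S, P S \is 2.-homog.

Definition euler : mvf K n := \sum_(i < n) 'X_i *: partial i.

Definition vact (X : mvf K n) f : {mpoly K[n]} :=
  \sum_(i < n) X [set i] * f^`M(i).

End Multivectors.

Section Lie.
Variables (K : fieldType) (L : vectType K) (br : L -> L -> L).

Definition lie_bracket :=
  [/\ forall a x y z, br (a *: x + y) z = a *: br x z + br y z,
      forall a x y z, br z (a *: x + y) = a *: br z x + br z y,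
      forall x, br x x = 0
    & forall x y z, br x (br y z) + br y (br z x) + br z (br x y) = 0].

Definition ideal (U : {vspace L}) := forall x u, u \in U -> br x u \in U.

Definition lieprod (U V : {vspace L}) : {vspace L} :=
  <<[seq br u v | u <- vbasis U, v <- vbasis V]>>%VS.

Definition solvable (U : {vspace L}) :=
  exists k, iter k (fun V => lieprod V V) U = 0%VS.

Definition semisimple := forall U, ideal U -> solvable U -> U = 0%VS.

(** A basis [b] of [L] is a system of linear coordinates on the dual of [L];
    [linfun_of b y] is [y : L] seen as a linear function on the dual. *)
Definition linfun_of n (b : n.-tuple L) (y : L) : {mpoly K[n]} :=
  \sum_(i < n) coord b i y *: 'X_i.

Definition lie_poisson n (b : n.-tuple L) : mvf K n :=
  \sum_(i < n) \sum_(j < n | (i < j)%N)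
    linfun_of b (br (tnth b i) (tnth b j)) *: wedge (partial K i) (partial K j).

End Lie.

(** The coordinates on the dual of [g = s + K] are [x_0 = (0, c)] with [c != 0], which
  vanishes on the dual of [s], followed by those on the dual of [s]. *)

Definition lift_fun (K : fieldType) n (f : {mpoly K[n]}) : {mpoly K[n.+1]} :=
  f \mPo [tuple 'X_(lift ord0 i) | i < n].

Definition lift_mv (K : fieldType) n (P : mvf K n) : mvf K n.+1 :=
  [ffun S : {set 'I_n.+1} => if ord0 \in S then 0 else lift_fun (P (lift ord0 @^-1: S))].

Section CentralExtension.
Variables (K : fieldType) (s : vectType K) (br : s -> s -> s).
Local Notation g := (s * K^o)%type.

Definition sum_coords n (b : n.-tuple s) (c : K) : n.+1.-tuple g :=
  [tuple of (0, c) :: map (fun y => (y, 0)) b].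

(** [a] is a linear form on [g], i.e. a point of its dual, with coordinates
    [a x_i]; the dual line of K is the set of those vanishing on [s]. *)
Definition centrally_linearizable n (b : n.-tuple s) (c : K)
    (eta : mvf K n.+1) :=
  let pt (a : 'Hom(g, K^o)) (i : 'I_n.+1) : K := a (tnth (sum_coords b c) i) in
  let T a : mvf K n.+1 := \sum_(i < n.+1) (pt a i)%:MP *: partial K i in
  exists a : 'Hom(g, K^o),
    [/\ forall y : s, a (y, 0) = 0,
        a != 0,
        forall S, (eta S).@[pt a] = 0
      & schouten (T a) eta = lift_mv (lie_poisson br b)].

End CentralExtension.

Section ExteriorTheory.
Variables (R : comNzRingType) (n : nat).
Implicit Types (A B C S : {set 'I_n}) (P Q T : ext R n) (i : 'I_n).

Lemma ninvUl A B C : [disjoint A & B] -> ninv (A :|: B) C = (ninv A C + ninv B C)%N.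
Proof.
move=> dAB; rewrite /ninv (eq_bigl [predU A & B]) ?bigU //= => i.
by rewrite !inE.
Qed.

Lemma ninvUr A B C : [disjoint A & B] -> ninv C (A :|: B) = (ninv C A + ninv C B)%N.
Proof.
move=> dAB; rewrite /ninv -big_split /=; apply: eq_bigr => c _.
by rewrite (eq_bigl [predU A & B]) ?bigU //= => i; rewrite !inE.
Qed.

Lemma ninv_flip A B : [disjoint A & B] -> (ninv A B + ninv B A)%N = (#|A| * #|B|)%N.
Proof.
move=> dAB; rewrite /ninv [X in (_ + X)%N]exchange_big -big_split /=.
rewrite -sum_nat_const; apply: eq_bigr => a Aa.
rewrite -big_split -sum1_card; apply: eq_bigr => b Bb /=.
case: ltngtP => // /val_inj eab; move: dAB => /pred0P /(_ a) /=.
by rewrite Aa -eab Bb.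
Qed.

Lemma ninv1_flip i A : i \notin A -> (ninv [set i] A + ninv A [set i])%N = #|A|.
Proof. by move=> iA; rewrite ninv_flip ?disjoints1 // cards1 mul1n. Qed.

Lemma disjoint_setU A B C :
  [disjoint A :|: B & C] = [disjoint A & C] && [disjoint B & C].
Proof. by rewrite -!setI_eq0 setIUl setU_eq0. Qed.

Lemma disjoint_setUr A B C :
  [disjoint C & A :|: B] = [disjoint C & A] && [disjoint C & B].
Proof. by rewrite -!setI_eq0 setIUr setU_eq0. Qed.

Lemma wedgeDl P Q T : wedge (P + Q) T = wedge P T + wedge Q T.
Proof.
apply/ffunP => S; rewrite !ffunE -big_split /=; apply: eq_bigr => A _.
by rewrite ffunE mulrDl mulrDr.
Qed.
Lemma wedgeDr P Q T : wedge T (P + Q) = wedge T P + wedge T Q.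
Proof.
apply/ffunP => S; rewrite !ffunE -big_split /=; apply: eq_bigr => A _.
by rewrite ffunE mulrDr mulrDr.
Qed.
Lemma wedgeZl (f : R) P Q : wedge (f *: P) Q = f *: wedge P Q.
Proof.
apply/ffunP => S; rewrite !ffunE /GRing.scale /= mulr_sumr.
by apply: eq_bigr => A _; rewrite ffunE /GRing.scale /= -(mulrA f) mulrCA.
Qed.
Lemma wedgeZr (f : R) P Q : wedge P (f *: Q) = f *: wedge P Q.
Proof.
apply/ffunP => S; rewrite !ffunE /GRing.scale /= mulr_sumr.
apply: eq_bigr => A _; rewrite ffunE /GRing.scale /=.
by rewrite (mulrCA (P A)) (mulrCA _ f).
Qed.
Lemma wedge0l Q : wedge 0 Q = 0.
Proof. by rewrite -[0 in LHS](scale0r (0 : ext R n)) wedgeZl scale0r. Qed.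
Lemma wedge0r Q : wedge Q 0 = 0.
Proof. by rewrite -[0 in LHS](scale0r (0 : ext R n)) wedgeZr scale0r. Qed.
Lemma wedgeNl P Q : wedge (- P) Q = - wedge P Q.
Proof. by rewrite -scaleN1r wedgeZl scaleN1r. Qed.
Lemma wedgeNr P Q : wedge P (- Q) = - wedge P Q.
Proof. by rewrite -scaleN1r wedgeZr scaleN1r. Qed.
Lemma wedge_suml I r (p : pred I) (F : I -> ext R n) Q :
  wedge (\sum_(i <- r | p i) F i) Q = \sum_(i <- r | p i) wedge (F i) Q.
Proof.
by apply: (big_rec2 (fun a b => wedge a Q = b)) => [|i a b _ <-];
  rewrite ?wedge0l ?wedgeDl.
Qed.
Lemma wedge_sumr I r (p : pred I) (F : I -> ext R n) Q :
  wedge Q (\sum_(i <- r | p i) F i) = \sum_(i <- r | p i) wedge Q (F i).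
Proof.
by apply: (big_rec2 (fun a b => wedge Q a = b)) => [|i a b _ <-];
  rewrite ?wedge0r ?wedgeDr.
Qed.

Lemma ebaseE P : P = \sum_A P A *: ebase R A.
Proof.
apply/ffunP => S; rewrite sum_ffunE (bigD1 S) //= big1 => [|A nA]; rewrite !ffunE.
  by rewrite eqxx addr0 /GRing.scale /= mulr1.
by rewrite eq_sym (negPf nA) scaler0.
Qed.

Lemma wedge_ebase A B : wedge (ebase R A) (ebase R B) =
  if [disjoint A & B] then (-1) ^+ ninv A B *: ebase R (A :|: B) else 0.
Proof.
apply/ffunP => S; rewrite ffunE.
have -> : \sum_(C : {set 'I_n} | C \subset S) (-1) ^+ ninv C (S :\: C) *
     (ebase R A C * ebase R B (S :\: C)) =
   if (A \subset S) && (S :\: A == B) then (-1) ^+ ninv A B else 0 :> R.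
  rewrite big_mkcond (bigD1 A) //= big1 ?addr0 => [|C nCA]; rewrite !ffunE.
    rewrite eqxx mul1r; case: (A \subset S) => //=.
    by case: eqP => [->|_]; rewrite ?mulr1 ?mulr0.
  by rewrite (negPf nCA) mul0r mulr0 if_same.
have -> : (A \subset S) && (S :\: A == B) = [disjoint A & B] && (S == A :|: B).
  apply/andP/andP => [[sAS /eqP <-]|[dAB /eqP ->]].
    split; last by rewrite setDE setUIr setUCr setIT (setUidPr sAS).
    by rewrite disjoints_subset setCD subsetUr.
  rewrite subsetUl setDUl setDv set0U; split=> //.
  by apply/eqP/setDidPl; rewrite disjoint_sym.
by case: disjoint; rewrite !ffunE // /GRing.scale /=; case: eqP; rewrite ?mulr1 ?mulr0.
Qed.

Lemma wedgeE P Q :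
  wedge P Q = \sum_A \sum_B (P A * Q B) *: wedge (ebase R A) (ebase R B).
Proof.
rewrite {1}(ebaseE P) wedge_suml; apply: eq_bigr => A _.
rewrite {1}(ebaseE Q) wedge_sumr; apply: eq_bigr => B _.
by rewrite wedgeZl wedgeZr scalerA.
Qed.

Lemma wedgeA P Q T : wedge P (wedge Q T) = wedge (wedge P Q) T.
Proof.
rewrite (ebaseE P) !wedge_suml; apply: eq_bigr => A _; rewrite !wedgeZl; congr (_ *: _).
rewrite (ebaseE Q) !(wedge_suml, wedge_sumr); apply: eq_bigr => B _.
rewrite !(wedgeZl, wedgeZr); congr (_ *: _).
rewrite (ebaseE T) !(wedge_suml, wedge_sumr); apply: eq_bigr => C _.
rewrite !(wedgeZl, wedgeZr); congr (_ *: _); rewrite !wedge_ebase.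
transitivity (if [&& [disjoint A & B], [disjoint A & C] & [disjoint B & C]] then
  (-1) ^+ (ninv A B + ninv A C + ninv B C) *: ebase R (A :|: B :|: C) else 0).
  case: (boolP [disjoint B & C]) => [dBC|_]; last by rewrite wedge0r !andbF.
  rewrite wedgeZr wedge_ebase disjoint_sym disjoint_setU !(disjoint_sym _ A) andbT.
  case: ifP => [dA|_]; last exact: scaler0.
  by rewrite scalerA -exprD ninvUr // setUA addnC.
symmetry; case: (boolP [disjoint A & B]) => [dAB|_]; last by rewrite wedge0l.
rewrite wedgeZl wedge_ebase disjoint_setU /=.
case: ifP => [dA|_]; last by rewrite scaler0.
by rewrite scalerA -exprD ninvUl // addnA.
Qed.

Lemma signD m k l : (m + k)%N = l -> (-1) ^+ m = (-1) ^+ l * (-1) ^+ k :> R.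
Proof. by move=> <-; rewrite exprD -mulrA -expr2 sqrr_sign mulr1. Qed.

Lemma wedgeC p q P Q : is_mv p P -> is_mv q Q ->
  wedge P Q = (-1) ^+ (p * q) *: wedge Q P.
Proof.
move=> hP hQ; rewrite wedgeE [wedge Q P]wedgeE exchange_big /=.
rewrite scaler_sumr; apply: eq_bigr => B _.
rewrite scaler_sumr; apply: eq_bigr => A _.
have [cA|nA] := eqVneq #|A| p; last by rewrite (hP A nA) mulr0 mul0r !scale0r scaler0.
have [cB|nB] := eqVneq #|B| q; last by rewrite (hQ B nB) mulr0 mul0r !scale0r scaler0.
rewrite !wedge_ebase disjoint_sym setUC; case: ifP => [dAB|_]; last by rewrite !scaler0.
rewrite (mulrC (P A)) !scalerA; congr (_ *: _).
rewrite [in RHS](mulrC _ (Q B * P A)) -[RHS]mulrA; congr (_ * _).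
by apply: signD; rewrite addnC (ninv_flip dAB) cA cB mulnC.
Qed.

Lemma lcontrD i P Q : lcontr i (P + Q) = lcontr i P + lcontr i Q.
Proof. by apply/ffunP => S; rewrite !ffunE; case: ifP; rewrite ?addr0 // mulrDr. Qed.
Lemma lcontrZ i f P : lcontr i (f *: P) = f *: lcontr i P.
Proof.
apply/ffunP => S; rewrite !ffunE /GRing.scale /=; case: ifP; rewrite ?mulr0 //.
by rewrite (mulrCA _ f).
Qed.
Lemma rcontrD i P Q : rcontr i (P + Q) = rcontr i P + rcontr i Q.
Proof. by apply/ffunP => S; rewrite !ffunE; case: ifP; rewrite ?addr0 // mulrDr. Qed.
Lemma rcontrZ i f P : rcontr i (f *: P) = f *: rcontr i P.
Proof.
apply/ffunP => S; rewrite !ffunE /GRing.scale /=; case: ifP; rewrite ?mulr0 //.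
by rewrite (mulrCA _ f).
Qed.

Lemma lcontr0 i : lcontr i (0 : ext R n) = 0.
Proof. by rewrite -[0 in LHS](scale0r (0 : ext R n)) lcontrZ scale0r. Qed.
Lemma lcontr_sum I r (p : pred I) (F : I -> ext R n) i :
  lcontr i (\sum_(k <- r | p k) F k) = \sum_(k <- r | p k) lcontr i (F k).
Proof.
by apply: (big_rec2 (fun a b => lcontr i a = b)) => [|k a b _ <-];
  rewrite ?lcontr0 ?lcontrD.
Qed.

Lemma lcontr_ebase i A : lcontr i (ebase R A) =
  if i \in A then (-1) ^+ ninv [set i] (A :\ i) *: ebase R (A :\ i) else 0.
Proof.
apply/ffunP => S; rewrite !ffunE; case: ifP => iS; case: ifP => iA; rewrite !ffunE //.
- have -> : S == A :\ i = false by apply/eqP => eS; rewrite eS !inE eqxx in iS.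
  by rewrite scaler0.
- have -> : (i |: S == A) = (S == A :\ i).
    by apply/eqP/eqP => [<-|->]; rewrite ?setD1K // setU1K // iS.
  by rewrite /GRing.scale /=; case: eqP => [->|]; rewrite ?mulr0.
- by case: eqP => [eA|]; rewrite ?mulr0 //; rewrite -eA !inE eqxx in iA.
Qed.

Lemma ninv11 i : ninv [set i] [set i] = 0%N.
Proof. by rewrite /ninv !big_set1 ltnn. Qed.

Lemma lcontr_wedge i p P Q : is_mv p P ->
  lcontr i (wedge P Q) = wedge (lcontr i P) Q + (-1) ^+ p *: wedge P (lcontr i Q).
Proof.
move=> hP; rewrite [P in LHS]ebaseE [in X in X + _](ebaseE P) [in X in _ + X](ebaseE P).
rewrite !(wedge_suml, lcontr_sum) scaler_sumr -big_split; apply: eq_bigr => A _ /=.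
have [cA|nA] := eqVneq #|A| p; last first.
  by rewrite (hP A nA) !scale0r lcontr0 !wedge0l lcontr0 scaler0 addr0.
rewrite !(wedgeZl, lcontrZ) scalerA mulrC -scalerA -scalerDr; congr (_ *: _).
rewrite (ebaseE Q) !(wedge_sumr, lcontr_sum) scaler_sumr -big_split.
apply: eq_bigr => B _ /=.
rewrite !(wedgeZr, lcontrZ) scalerA mulrC -scalerA -scalerDr; congr (_ *: _).
rewrite !lcontr_ebase wedge_ebase -{p hP}cA.
have exI C : i \in C -> exists2 C' : {set 'I_n}, i \notin C' & C = i |: C'.
  by move=> iC; exists (C :\ i); rewrite ?setD1K // !inE eqxx.
have [/exI [A' iA ->]|iA] := boolP (i \in A);
  have [/exI [B' iB ->]|iB] := boolP (i \in B).
- rewrite !setU1K //.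
  have -> : [disjoint i |: A' & i |: B'] = false.
    by apply/pred0P => /(_ i) /=; rewrite !inE eqxx.
  rewrite lcontr0 wedgeZl wedgeZr !wedge_ebase disjoint_setUr disjoint_setU.
  rewrite disjoint_sym !disjoints1 iA iB /= setUA (setUC A') -setUA.
  case: (boolP [disjoint A' & B']) => dAB; last by rewrite !scaler0 addr0.
  rewrite !scalerA -scalerDl -!exprD.
  rewrite (ninvUr A') ?disjoints1 // (ninvUl _ (A := [set i])) ?disjoints1 //.
  rewrite cardsU1 iA -(ninv1_flip iA) !exprD expr1; set a := (-1) ^+ ninv [set i] A'.
  set b := (-1) ^+ ninv [set i] B'; set d := (-1) ^+ ninv A' B'.
  set e := (-1) ^+ ninv A' [set i].
  have b2 : b * b = 1 by rewrite -expr2 sqrr_sign.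
  apply/esym; rewrite [X in X *: _](_ : _ = 0) ?scale0r //.
  by rewrite !mulN1r !mulNr -!mulrA (mulrA b) b2 mul1r subrr.
- rewrite !setU1K // wedgeZl wedge0r scaler0 addr0 wedge_ebase disjoint_setU.
  rewrite disjoints1 iB /=; case: (boolP [disjoint A' & B]) => dAB; last by rewrite lcontr0 scaler0.
  rewrite lcontrZ lcontr_ebase !inE eqxx /= -setUA setU1K; last by rewrite !inE negb_or iA.
  rewrite !scalerA; congr (_ *: _); rewrite (ninvUl _ (A := [set i])) ?disjoints1 //.
  rewrite (ninvUr _ (A := A')) // !exprD.
  set a := (-1) ^+ ninv [set i] A'.
  set b := (-1) ^+ ninv [set i] B; set d := (-1) ^+ ninv A' B.
  have b2 : b * b = 1 by rewrite -expr2 sqrr_sign.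
  by rewrite [a * b]mulrC mulrCA mulrA (mulrA b) b2 mul1r mulrC.
- rewrite !setU1K // wedgeZr wedge0l add0r wedge_ebase disjoint_setUr.
  rewrite disjoint_sym disjoints1 iA /=.
  case: (boolP [disjoint A & B']) => dAB; last by rewrite lcontr0 !scaler0.
  rewrite lcontrZ lcontr_ebase setUCA !inE eqxx /= setU1K; last by rewrite !inE negb_or iA.
  rewrite !scalerA; congr (_ *: _); rewrite (ninvUr A (A := [set i])) ?disjoints1 //.
  rewrite (ninvUr _ (A := A)) // -(ninv1_flip iA) -!exprD; congr (_ ^+ _).
  by rewrite addnC -!addnA; congr addn; rewrite addnCA; congr addn; rewrite addnC.
- rewrite wedge0l wedge0r scaler0 addr0; case: ifP => [_|_]; last exact: lcontr0.
  by rewrite lcontrZ lcontr_ebase !inE (negPf iA) (negPf iB) scaler0.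
Qed.

Lemma rcontrE i p P : is_mv p P -> rcontr i P = (-1) ^+ p.+1 *: lcontr i P.
Proof.
move=> hP; apply/ffunP => S; rewrite !ffunE /GRing.scale /=.
case: (boolP (i \in S)) => iS; first by rewrite mulr0.
have [cS|nS] := eqVneq #|i |: S| p; last by rewrite (hP _ nS) !mulr0.
rewrite mulrA; congr (_ * _); rewrite -cS cardsU1 iS.
rewrite addnC addn1 -addn2 exprD sqrrN expr1n mulr1; apply: signD.
by rewrite addnC ninv1_flip.
Qed.

Lemma is_mv0 p : is_mv p (0 : ext R n).
Proof. by move=> S _; rewrite ffunE. Qed.

Lemma is_mvD p P Q : is_mv p P -> is_mv p Q -> is_mv p (P + Q).
Proof. by move=> hP hQ S nS; rewrite ffunE hP // hQ // addr0. Qed.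

Lemma is_mvZ p f P : is_mv p P -> is_mv p (f *: P).
Proof. by move=> hP S nS; rewrite ffunE hP // scaler0. Qed.

Lemma is_mvN p P : is_mv p P -> is_mv p (- P).
Proof. by rewrite -scaleN1r; exact: is_mvZ. Qed.

Lemma is_mv_sum p I r (c : pred I) (F : I -> ext R n) :
  (forall k, c k -> is_mv p (F k)) -> is_mv p (\sum_(k <- r | c k) F k).
Proof. by move=> hF; elim/big_ind: _ => //; [exact: is_mv0 | exact: is_mvD]. Qed.

Lemma is_mv_ebase A : is_mv #|A| (ebase R A).
Proof. by move=> S nS; rewrite ffunE; case: eqP => // eS; rewrite eS eqxx in nS. Qed.

Lemma is_mv_of_fun (f : R) : is_mv 0 (of_fun n f).
Proof. by move=> S nS; rewrite ffunE -cards_eq0 (negPf nS). Qed.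

Lemma is_mv_wedge p q P Q : is_mv p P -> is_mv q Q -> is_mv (p + q) (wedge P Q).
Proof.
move=> hP hQ S nS; rewrite ffunE big1 // => A sAS.
have [cA|nA] := eqVneq #|A| p; last by rewrite hP // mul0r mulr0.
rewrite hQ ?mulr0 //; apply/eqP => cD; case/eqP: nS; rewrite -cD.
by rewrite cardsDS // -cA subnKC // subset_leq_card.
Qed.

Lemma is_mv_lcontr p i P : is_mv p.+1 P -> is_mv p (lcontr i P).
Proof.
move=> hP S nS; rewrite ffunE; case: ifP => // iS.
by rewrite hP ?mulr0 // cardsU1 iS.
Qed.

Lemma lcontr_fun i P : is_mv 0 P -> lcontr i P = 0.
Proof.
move=> hP; apply/ffunP => S; rewrite !ffunE; case: ifP => // iS.
by rewrite hP ?mulr0 // cardsU1 iS.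
Qed.

Lemma wedge_lcontrC p q i P Q : is_mv p P -> is_mv q Q ->
  wedge (lcontr i P) Q = (-1) ^+ (p.+1 * q) *: wedge Q (lcontr i P).
Proof.
case: p => [|p] hP hQ; first by rewrite (lcontr_fun i hP) wedge0l wedge0r scaler0.
rewrite (wedgeC (is_mv_lcontr i hP) hQ); congr (_ *: _).
by rewrite -addn2 mulnDl exprD mul2n -addnn exprD -expr2 sqrr_sign mulr1.
Qed.

Lemma wedge_rcontrC p q i P Q : is_mv p P -> is_mv q Q ->
  wedge (rcontr i P) Q = (-1) ^+ (p.+1 * q.+1) *: wedge Q (lcontr i P).
Proof.
move=> hP hQ; rewrite (rcontrE i hP) wedgeZl (wedge_lcontrC i hP hQ).
by rewrite scalerA -exprD -mulnS.
Qed.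

Lemma wedge_funl (f : R) P : wedge (of_fun n f) P = f *: P.
Proof.
apply/ffunP => S; rewrite !ffunE.
rewrite (bigD1 set0) ?sub0set //= big1 => [|A /andP[_ nA]].
  by rewrite /ninv big_set0 mul1r ffunE eqxx setD0 addr0.
by rewrite ffunE (negPf nA) mul0r mulr0.
Qed.

Lemma schouten_termZ i (a : R) P P' Q Q' :
  wedge (rcontr i (a *: P)) Q' - wedge (a *: P') (lcontr i Q) =
    a *: (wedge (rcontr i P) Q' - wedge P' (lcontr i Q)) /\
  wedge (rcontr i P) (a *: Q') - wedge P' (lcontr i (a *: Q)) =
    a *: (wedge (rcontr i P) Q' - wedge P' (lcontr i Q)).
Proof. by rewrite rcontrZ lcontrZ !wedgeZl !wedgeZr !scalerBr. Qed.

Lemma wedge_schouten_term i p q P P' Q Q' T T' :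
  is_mv p P -> is_mv p P' -> is_mv q Q ->
  wedge (rcontr i P) (wedge Q' T + wedge Q T') - wedge P' (lcontr i (wedge Q T)) =
  wedge (wedge (rcontr i P) Q' - wedge P' (lcontr i Q)) T +
  (-1) ^+ (p.+1 * q) *: wedge Q (wedge (rcontr i P) T' - wedge P' (lcontr i T)).
Proof.
move=> hP hP' hQ; rewrite (lcontr_wedge i _ hQ) !wedgeDr !wedgeDl wedgeNr wedgeNl.
rewrite scalerDr scalerN wedgeZr !wedgeA.
have -> : wedge (wedge (rcontr i P) Q) T' =
    (-1) ^+ (p.+1 * q) *: wedge (wedge Q (rcontr i P)) T'.
  rewrite (rcontrE i hP) wedgeZl (wedge_lcontrC i hP hQ) wedgeZr !wedgeZl.
  by rewrite !scalerA mulrC.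
rewrite (wedgeC hP' hQ) wedgeZl scalerA -exprD mulSn.
by rewrite opprD !addrA; congr (_ - _); rewrite addrAC.
Qed.

Lemma of_funE (f : R) S : of_fun n f S = if S == set0 then f else 0.
Proof. by rewrite ffunE. Qed.

Lemma of_funM (f g : R) : of_fun n (f * g) = f *: of_fun n g.
Proof. by apply/ffunP => S; rewrite !ffunE; case: eqP; rewrite ?scaler0. Qed.

Lemma of_fun_sum I r (c : pred I) (F : I -> R) :
  of_fun n (\sum_(k <- r | c k) F k) = \sum_(k <- r | c k) of_fun n (F k).
Proof.
apply/ffunP => S; rewrite sum_ffunE of_funE; case: eqP => [->|/eqP nS].
  by apply: eq_bigr => k _; rewrite of_funE eqxx.
by rewrite big1 // => k _; rewrite of_funE (negPf nS).
Qed.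

Lemma scaleE (f : R) P S : (f *: P) S = f * P S.
Proof. by rewrite ffunE. Qed.

Lemma contr1 i P : is_mv 1 P ->
  lcontr i P = of_fun n (P [set i]) /\ rcontr i P = of_fun n (P [set i]).
Proof.
move=> hP; rewrite (rcontrE i hP) expr2 mulN1r opprK scale1r.
suff -> : lcontr i P = of_fun n (P [set i]) by [].
apply/ffunP => S; rewrite !ffunE /GRing.scale /=.
have [->|nS] := eqVneq S set0.
  by rewrite inE setU0 /ninv big_set1 big_set0 mul1r.
case: ifP => // iS; rewrite hP ?mulr0 // cardsU1 iS.
by rewrite add1n eqSS cards_eq0.
Qed.

Lemma wedge_funr (f : R) P : wedge P (of_fun n f) = f *: P.
Proof.
apply/ffunP => S; rewrite !ffunE.
rewrite (bigD1 S) //= big1 => [|A /andP[sAS nA]]; last first.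
  rewrite ffunE ifN ?mulr0 // setD_eq0; apply: contraNN nA => sSA.
  by rewrite eqEsubset sAS.
rewrite setDv ffunE eqxx /ninv big1 ?mul1r ?addr0; first exact: mulrC.
by move=> a _; rewrite big_set0.
Qed.

Lemma pair_coef (i j k l : 'I_n) (a : R) : (i < j)%N -> (l < k)%N ->
  (a *: wedge (ebase R [set i]) (ebase R [set j])) (k |: [set l]) =
  if (i == l) && (j == k) then a else 0.
Proof.
move=> ij lk; rewrite wedge_ebase disjoints1 inE neq_ltn ij /=.
rewrite /ninv !big_set1 ltnNge ltnW //= scale1r ffunE ffunE /GRing.scale /=.
have -> : (k |: [set l] == [set i] :|: [set j]) = (i == l) && (j == k).
  apply/eqP/andP => [/setP e|[/eqP <- /eqP <-]]; last by rewrite setUC.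
  have := e i; have := e j; rewrite !inE !eqxx orbT /=.
  case/orP => /eqP ej; case/orP => /eqP ei; subst; rewrite ?ltnn // in ij *.
  by rewrite ltnNge ltnW in ij.
by case: andP => _; rewrite ?mulr1 ?mulr0.
Qed.

Lemma ext_sumE I r (p : pred I) (F : I -> ext R n) S :
  (\sum_(i <- r | p i) F i) S = \sum_(i <- r | p i) F i S.
Proof.
by apply: (big_rec2 (fun a b => (a : ext R n) S = b)) => [|i a b _ <-];
  rewrite ffunE.
Qed.

Lemma pair_sum_coef (c : 'I_n -> 'I_n -> R) (k l : 'I_n) : (l < k)%N ->
  (\sum_(i < n) \sum_(j < n | (i < j)%N)
     c i j *: wedge (ebase R [set i]) (ebase R [set j])) (k |: [set l]) = c l k.
Proof.
move=> lk; rewrite ext_sumE (bigD1 l) //= ext_sumE (bigD1 k) //=.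
rewrite (pair_coef _ lk lk) !eqxx /= big1 => [|j /andP[lj nj]]; last first.
  by rewrite (pair_coef _ lj lk) (negPf nj) andbF.
rewrite addr0 big1 => [|i ni]; first exact: addr0.
rewrite ext_sumE big1 // => j ij.
by rewrite (pair_coef _ ij lk) (negPf ni).
Qed.

Lemma is_mv_pair (i j : 'I_n) (a : R) :
  is_mv 2 (a *: wedge (ebase R [set i]) (ebase R [set j])).
Proof.
apply: is_mvZ; apply: (@is_mv_wedge 1 1).
  by rewrite -(cards1 i); exact: is_mv_ebase.
by rewrite -(cards1 j); exact: is_mv_ebase.
Qed.
End ExteriorTheory.

Section MultivectorTheory.
Variables (K : fieldType) (n : nat).
Implicit Types (P Q T X Y : mvf K n) (f g : {mpoly K[n]}) (i j : 'I_n).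

Lemma mderiv_sign i k f : ((-1) ^+ k * f)^`M(i) = (-1) ^+ k * f^`M(i).
Proof. by rewrite -signr_odd !mulr_sign; case: odd; rewrite ?mderivN. Qed.

Lemma dcoefE i P (S : {set 'I_n}) : dcoef i P S = (P S)^`M(i).
Proof. by rewrite /dcoef ffunE. Qed.

Lemma dcoef_wedge i P Q :
  dcoef i (wedge P Q) = wedge (dcoef i P) Q + wedge P (dcoef i Q).
Proof.
apply/ffunP => S; rewrite !ffunE raddf_sum -big_split; apply: eq_bigr => A _ /=.
by rewrite mderiv_sign mderivM !ffunE mulrDr.
Qed.

Lemma is_mv_dcoef p i P : is_mv p P -> is_mv p (dcoef i P).
Proof. by move=> hP S nS; rewrite ffunE hP // mderiv0. Qed.

(** The normalization of the Schouten bracket.  Signs (-1)^(p-1) are written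
    (-1)^(p+1), since truncated subtraction would be wrong for p = 0. *)
Lemma schouten_anti p q P Q : is_mv p P -> is_mv q Q ->
  schouten P Q = - ((-1) ^+ (p.+1 * q.+1) *: schouten Q P).
Proof.
move=> hP hQ; rewrite /schouten scaler_sumr -sumrN; apply: eq_bigr => i _.
rewrite (wedge_rcontrC i hP (is_mv_dcoef i hQ)).
rewrite (wedge_rcontrC i hQ (is_mv_dcoef i hP)).
by rewrite scalerBr scalerA mulnC -expr2 sqrr_sign scale1r opprB.
Qed.

Lemma schouten_wedge p q P Q T : is_mv p P -> is_mv q Q ->
  schouten P (wedge Q T) =
    wedge (schouten P Q) T + (-1) ^+ (p.+1 * q) *: wedge Q (schouten P T).
Proof.
move=> hP hQ; rewrite /schouten wedge_suml wedge_sumr scaler_sumr -big_split.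
apply: eq_bigr => i _; rewrite dcoef_wedge.
exact: wedge_schouten_term hP (is_mv_dcoef i hP) hQ.
Qed.

Lemma is_mv_schouten p q P Q : is_mv p P -> is_mv q Q ->
  is_mv (p + q).-1 (schouten P Q).
Proof.
move=> hP hQ; apply: is_mv_sum => i _; apply: is_mvD; last apply: is_mvN.
  rewrite (rcontrE i hP) wedgeZl; apply: is_mvZ; case: p hP => [|p] hP.
    by rewrite (lcontr_fun i hP) wedge0l; exact: is_mv0.
  exact: is_mv_wedge (is_mv_lcontr i hP) (is_mv_dcoef i hQ).
case: q hQ => [|q] hQ; first by rewrite (lcontr_fun i hQ) wedge0r; exact: is_mv0.
by rewrite addnS; exact: is_mv_wedge (is_mv_dcoef i hP) (is_mv_lcontr i hQ).
Qed.

Lemma dcoef_of_fun i f : dcoef i (of_fun n f) = of_fun n f^`M(i).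
Proof.
apply/ffunP => S; rewrite dcoefE !of_funE.
by case: eqP => _ //; exact: mderiv0.
Qed.

Lemma schouten_fun X f : is_mv 1 X -> schouten X (of_fun n f) = of_fun n (vact X f).
Proof.
move=> hX; rewrite /vact of_fun_sum; apply: eq_bigr => i _.
rewrite (lcontr_fun i (is_mv_of_fun f)) wedge0r subr0.
by rewrite (contr1 i hX).2 dcoef_of_fun wedge_funl of_funM.
Qed.

Lemma schouten1E X Y : is_mv 1 X -> is_mv 1 Y ->
  schouten X Y = \sum_i (X [set i] *: dcoef i Y - Y [set i] *: dcoef i X).
Proof.
move=> hX hY; apply: eq_bigr => i _.
rewrite (contr1 i hX).2 (contr1 i hY).1 wedge_funl; congr (_ - _).
rewrite (wedgeC (is_mv_dcoef i hX) (is_mv_of_fun (Y [set i]))).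
by rewrite muln0 scale1r wedge_funl.
Qed.

Lemma schouten_lie X Y f : is_mv 1 X -> is_mv 1 Y ->
  vact (schouten X Y) f = vact X (vact Y f) - vact Y (vact X f).
Proof.
move=> hX hY; rewrite schouten1E // /vact.
have E (Z W : mvf K n) :
    \sum_i Z [set i] * (\sum_j W [set j] * f^`M(j))^`M(i) =
    \sum_j \sum_i Z [set i] * (W [set j])^`M(i) * f^`M(j)
    + \sum_i \sum_j Z [set i] * W [set j] * f^`M(j)^`M(i).
  rewrite exchange_big -big_split; apply: eq_bigr => i _ /=.
  rewrite raddf_sum mulr_sumr -big_split; apply: eq_bigr => j _ /=.
  by rewrite mderivM mulrDr !mulrA.
rewrite !E opprD addrACA [X in _ + (_ - X)]exchange_big.
rewrite -!sumrB [X in _ + X]big1 => [|i _]; last first.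
  rewrite -sumrB big1 // => j _.
  by rewrite (mderiv_comm i j) [X in _ - X * _]mulrC subrr.
rewrite addr0; apply: eq_bigr => j _; rewrite sum_ffunE -sumrB mulr_suml.
by apply: eq_bigr => i _; rewrite !ffunE mulrBl.
Qed.

Lemma schoutenDl P Q T : schouten (P + Q) T = schouten P T + schouten Q T.
Proof.
rewrite -big_split; apply: eq_bigr => i _ /=.
rewrite rcontrD.
have -> : dcoef i (P + Q) = dcoef i P + dcoef i Q.
  by apply/ffunP => S; rewrite !ffunE mderivD.
by rewrite !wedgeDl opprD addrACA.
Qed.

Lemma schoutenDr P Q T : schouten T (P + Q) = schouten T P + schouten T Q.
Proof.
rewrite -big_split; apply: eq_bigr => i _ /=.
have -> : dcoef i (P + Q) = dcoef i P + dcoef i Q.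
  by apply/ffunP => S; rewrite !ffunE mderivD.
by rewrite lcontrD !wedgeDr opprD addrACA.
Qed.

Lemma schoutenZ (a : K) P Q :
  schouten (a%:MP *: P) Q = a%:MP *: schouten P Q /\
  schouten P (a%:MP *: Q) = a%:MP *: schouten P Q.
Proof.
have dZ i T : dcoef i (a%:MP *: T) = a%:MP *: dcoef i T.
  apply/ffunP => S; rewrite dcoefE !scaleE dcoefE.
  by rewrite mderivM mderivC mul0r add0r.
split; rewrite scaler_sumr; apply: eq_bigr => i _; rewrite dZ.
  exact: (schouten_termZ i _ _ _ _ _).1.
exact: (schouten_termZ i _ _ _ _ _).2.
Qed.


Lemma hamE eta f : ham eta f = \sum_(k < n) f^`M(k) *: rcontr k eta.
Proof.
apply: eq_bigr => k _; rewrite (lcontr_fun k (is_mv_of_fun f)) wedge0r subr0.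
by rewrite dcoef_of_fun wedge_funr.
Qed.

End MultivectorTheory.

Section LiePoissonTheory.
Variables (K : fieldType) (L : vectType K) (br : L -> L -> L).
Hypothesis hbr : lie_bracket br.

Lemma brDl x y z : br (x + y) z = br x z + br y z.
Proof. by case: hbr => h _ _ _; rewrite -[x]scale1r h !scale1r. Qed.
Lemma brDr x y z : br z (x + y) = br z x + br z y.
Proof. by case: hbr => _ h _ _; rewrite -[x]scale1r h !scale1r. Qed.
Lemma br0l z : br 0 z = 0.
Proof. by apply: (addrI (br 0 z)); rewrite -brDl !addr0. Qed.
Lemma br0r z : br z 0 = 0.
Proof. by apply: (addrI (br z 0)); rewrite -brDr !addr0. Qed.
Lemma brZl a x z : br (a *: x) z = a *: br x z.
Proof. by case: hbr => h _ _ _; rewrite -[_ *: x]addr0 h br0l addr0. Qed.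
Lemma brZr a x z : br z (a *: x) = a *: br z x.
Proof. by case: hbr => _ h _ _; rewrite -[_ *: x]addr0 h br0r addr0. Qed.
Lemma brC x y : br x y = - br y x.
Proof.
case: hbr => _ _ h _; apply/eqP; rewrite -addr_eq0.
by have := h (x + y); rewrite brDl !brDr !h add0r addr0 => ->.
Qed.
Lemma br_suml I r (c : pred I) (F : I -> L) z :
  br (\sum_(i <- r | c i) F i) z = \sum_(i <- r | c i) br (F i) z.
Proof.
by apply: (big_rec2 (fun a b => br a z = b)) => [|k a b _ <-]; rewrite ?br0l ?brDl.
Qed.
Lemma br_sumr I r (c : pred I) (F : I -> L) z :
  br z (\sum_(i <- r | c i) F i) = \sum_(i <- r | c i) br z (F i).
Proof.
by apply: (big_rec2 (fun a b => br z a = b)) => [|k a b _ <-]; rewrite ?br0r ?brDr.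
Qed.

Variables (n : nat) (b : n.-tuple L).

Lemma linfun_ofD y z : linfun_of b (y + z) = linfun_of b y + linfun_of b z.
Proof. by rewrite -big_split; apply: eq_bigr => i _; rewrite linearD scalerDl. Qed.
Lemma linfun_ofZ a y : linfun_of b (a *: y) = a *: linfun_of b y.
Proof. by rewrite scaler_sumr; apply: eq_bigr => i _; rewrite linearZ scalerA. Qed.
Lemma linfun_of0 : linfun_of b 0 = 0.
Proof. by rewrite -[0 in LHS](scale0r (0 : L)) linfun_ofZ scale0r. Qed.
Lemma linfun_ofN y : linfun_of b (- y) = - linfun_of b y.
Proof. by rewrite -scaleN1r linfun_ofZ scaleN1r. Qed.
Lemma linfun_of_sum I r (c : pred I) (F : I -> L) :
  linfun_of b (\sum_(i <- r | c i) F i) = \sum_(i <- r | c i) linfun_of b (F i).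
Proof.
by apply: (big_rec2 (fun x y => linfun_of b x = y)) => [|k x y _ <-];
  rewrite ?linfun_of0 ?linfun_ofD.
Qed.

Lemma mderiv_linfun i y : (linfun_of b y)^`M(i) = (coord b i y)%:MP.
Proof.
rewrite /linfun_of raddf_sum (bigD1 i) //= big1 => [|j nj]; rewrite mderivZ mderivX.
  by rewrite mnm1E eqxx addr0 scale1r -[X in (X - _)%MM]add0m addmK mpolyX0 -mul_mpolyC mulr1.
by rewrite mnm1E (negPf nj) scale0r scaler0.
Qed.

Lemma is_mv_lie_poisson : is_mv 2 (lie_poisson br b).
Proof.
by apply: is_mv_sum => i _; apply: is_mv_sum => j _; exact: is_mv_pair.
Qed.

Lemma lie_poisson_coef (k l : 'I_n) : (l < k)%N ->
  lie_poisson br b (k |: [set l]) = linfun_of b (br (tnth b l) (tnth b k)).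
Proof.
by move=> lk; exact: (pair_sum_coef
  (fun i j => linfun_of b (br (tnth b i) (tnth b j))) lk).
Qed.

(** {y, z} = [y, z], where {f, g} = (eta(g)) f. *)
Lemma lie_poisson_bracket (y z : L) : basis_of fullv b ->
  vact (ham (lie_poisson br b) (linfun_of b z)) (linfun_of b y)
    = linfun_of b (br y z).
Proof.
move=> hb.
have e w : w = \sum_i coord b i w *: tnth b i.
  rewrite {1}(coord_basis hb (memvf w)); apply: eq_bigr => i _.
  by rewrite -tnth_nth.
rewrite {2}(e y) {2}(e z) br_suml linfun_of_sum; apply: eq_bigr => l _.
rewrite br_sumr linfun_of_sum hamE ext_sumE mulr_suml; apply: eq_bigr => k _.
rewrite brZl brZr !linfun_ofZ !mderiv_linfun scaleE.
rewrite -!mul_mpolyC mulrC; congr (_ * _); congr (_ * _).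
rewrite ffunE inE; case: eqP => [->|/eqP nkl].
  by case: hbr => _ _ -> _; rewrite linfun_of0.
rewrite /ninv !big_set1; case: ltngtP (nkl) => // kl _.
- by rewrite setUC lie_poisson_coef // expr1 mulN1r -linfun_ofN -brC.
- by rewrite lie_poisson_coef // expr0 mul1r.
- by move/val_inj: kl nkl => ->; rewrite eqxx.
Qed.

End LiePoissonTheory.

(* Main.v *)
From HB Require Import structures.
Require Import Defs.
From mathcomp Require Import all_boot all_order all_algebra.
From mathcomp Require Import mpoly complex reals.
Set Implicit Arguments.
Unset Strict Implicit.
Unset Printing Implicit Defensive.
Import GRing.Theory.
Local Open Scope ring_scope.

(** Write [P] for the Lie-Poisson bivector, [l] for [x] seen as a linear
  function, [V = P(l)] for its hamiltonian field and [E] for the Euler field.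
  Everything rests on the bracket relations between these objects:
  [P,P] = 0, [P,l] = V, [P,V] = 0, [P,E] = P, [E,l] = l and
  [V,l] = [V,E] = 0.

  The Leibniz rule gives [l E, P] = - (l P + V /\ E), and the bivector of the
  theorem on the extended space is - (t P + V /\ W) with t = l - x_0 and
  W = E + l d/dx_0.  Both are of one shape, which [twist_self] computes once:
  if P is Poisson, V = [P,t] satisfies [P,V] = [V,t] = [V,W] = 0, and
  [W,t] = a, [P,W] = P + V /\ Z, then w = t P + V /\ W satisfies
  [w,w] = 2 a V /\ P, whatever Z is.  On the dual of s one has t = a = l and
  Z = 0, whence [w,w] = 2 l V /\ P = 2 P(q) /\ P.  On the extended space the
  summand l d/dx_0 of W is exactly what makes [W,t] = l - l vanish, so that
  a = 0 and the bivector is Poisson.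

  The relations come from the fields V_y = P(y), y in s.  The Jacobi
  identity of s says that [V_y,V_z] = V_[z,y] ([hamfield_schouten]).
  Together with 2 P = sum_i V_i /\ d/dx_i, where V_i is the field of the i-th
  basis vector, it gives the invariance [V_y,P] = 0
  ([lie_poisson_invariant]), and then [P,P] = 0: the coordinate formula reads
  [P,P] = 2 A for A = sum_i V_i /\ dP/dx_i, whereas invariance and the
  Leibniz rule give 2 [P,P] = A ([lie_poisson_poisson]).  Euler's formula for
  linear functions handles the relations with E, and the passage to the
  extended space is a morphism for all operations ([lift_schouten]).

  The constant field d/dx_0 satisfies [d/dx_0, t] = -1 and commutes with P, V
  and W, so that it brings - (t P + V /\ W) back to P; and this bivector
  vanishes on the dual line because P and V have linear coefficients in the
  coordinates other than x_0. *)

(** * Calculus of the Schouten bracket *)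

Section BracketCalculus.
Variables (K : fieldType) (n : nat).
Implicit Types (P Q T X Y : mvf K n) (f g : {mpoly K[n]}) (i j : 'I_n).

Lemma schouten0l P : schouten 0 P = 0.
Proof. by apply: (addIr (schouten 0 P)); rewrite -schoutenDl !add0r. Qed.

Lemma schouten0r P : schouten P 0 = 0.
Proof. by apply: (addIr (schouten P 0)); rewrite -schoutenDr !add0r. Qed.

Lemma schoutenNl P Q : schouten (- P) Q = - schouten P Q.
Proof. by apply: (addIr (schouten P Q)); rewrite -schoutenDl !addNr schouten0l. Qed.

Lemma schoutenNr P Q : schouten P (- Q) = - schouten P Q.
Proof. by apply: (addIr (schouten P Q)); rewrite -schoutenDr !addNr schouten0r. Qed.

Lemma schouten_sumr I r (p : pred I) (F : I -> mvf K n) P :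
  schouten P (\sum_(i <- r | p i) F i) = \sum_(i <- r | p i) schouten P (F i).
Proof. exact: (big_morph (schouten P) (fun Q T => schoutenDr Q T P) (schouten0r P)). Qed.

Lemma schouten_scale p P f Q : is_mv p P ->
  schouten P (f *: Q) = wedge (schouten P (of_fun n f)) Q + f *: schouten P Q.
Proof.
move=> hP; rewrite -wedge_funl (schouten_wedge _ hP (is_mv_of_fun f)).
by rewrite muln0 expr0 scale1r wedge_funl.
Qed.

Lemma schouten_wedge1 p P X Q : is_mv p P -> is_mv 1 X ->
  schouten P (wedge X Q) =
    wedge (schouten P X) Q + (-1) ^+ p.+1 *: wedge X (schouten P Q).
Proof. by move=> hP hX; rewrite (schouten_wedge _ hP hX) muln1. Qed.

Lemma schoutenMnr P Q m : schouten P (Q *+ m) = schouten P Q *+ m.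
Proof. by elim: m => [|m IH]; rewrite ?mulr0n ?schouten0r // !mulrS schoutenDr IH. Qed.

Lemma sum_partial_coef (F : 'I_n -> {mpoly K[n]}) k :
  (\sum_i F i *: partial K i) [set k] = F k.
Proof.
rewrite ext_sumE (bigD1 k) //= big1 => [|j nj]; rewrite !ffunE /GRing.scale /=.
  by rewrite eqxx mulr1 addr0.
by rewrite (inj_eq (@set1_inj _)) eq_sym (negPf nj) mulr0.
Qed.

Lemma euler_coef k : euler K n [set k] = 'X_k.
Proof. exact: sum_partial_coef. Qed.

Lemma vact_euler f : vact (euler K n) f = \sum_i 'X_i * f^`M(i).
Proof. by apply: eq_bigr => i _; rewrite euler_coef. Qed.

Lemma is_mv_partial i : is_mv 1 (partial K i).
Proof. by rewrite -(cards1 i); exact: is_mv_ebase. Qed.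

Lemma is_mv_euler : is_mv 1 (euler K n).
Proof. by apply: is_mv_sum => i _; apply: is_mvZ; exact: is_mv_partial. Qed.

Lemma mv1P X Y : is_mv 1 X -> is_mv 1 Y ->
  (forall i, X [set i] = Y [set i]) -> X = Y.
Proof.
move=> hX hY eXY; apply/ffunP => S; have [|nS] := eqVneq #|S| 1%N.
  by move/eqP/cards1P => [i ->].
by rewrite hX // hY.
Qed.

Lemma mv1E X : is_mv 1 X -> X = \sum_i X [set i] *: partial K i.
Proof.
move=> hX; apply: mv1P => [//||i]; last by rewrite sum_partial_coef.
by apply: is_mv_sum => i _; apply: is_mvZ; exact: is_mv_partial.
Qed.

Lemma schouten1_coef X Y k : is_mv 1 X -> is_mv 1 Y ->
  schouten X Y [set k] = vact X (Y [set k]) - vact Y (X [set k]).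
Proof.
move=> hX hY; rewrite schouten1E // ext_sumE -sumrB; apply: eq_bigr => i _.
by rewrite !ffunE.
Qed.

Lemma is_mv_schouten11 X Y : is_mv 1 X -> is_mv 1 Y -> is_mv 1 (schouten X Y).
Proof. exact: is_mv_schouten. Qed.

Lemma schouten11C X Y : is_mv 1 X -> is_mv 1 Y -> schouten X Y = - schouten Y X.
Proof. by move=> hX hY; rewrite (schouten_anti hX hY) -signr_odd scale1r. Qed.

Lemma schouten12C X Q : is_mv 1 X -> is_mv 2 Q -> schouten X Q = - schouten Q X.
Proof. by move=> hX hY; rewrite (schouten_anti hX hY) -signr_odd scale1r. Qed.

Lemma schouten21C X Q : is_mv 1 X -> is_mv 2 Q -> schouten Q X = - schouten X Q.
Proof. by move=> hX hY; rewrite (schouten12C hX hY) opprK. Qed.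

Lemma schouten22C P Q : is_mv 2 P -> is_mv 2 Q -> schouten P Q = schouten Q P.
Proof. by move=> hX hY; rewrite (schouten_anti hX hY) -signr_odd expr1 scaleN1r opprK. Qed.

Lemma schouten02C f Q : is_mv 2 Q -> schouten Q (of_fun n f) = schouten (of_fun n f) Q.
Proof.
by move=> hX; rewrite (schouten_anti hX (is_mv_of_fun f)) -signr_odd expr1 scaleN1r opprK.
Qed.

Lemma schouten01C f X : is_mv 1 X -> schouten (of_fun n f) X = - schouten X (of_fun n f).
Proof.
by move=> hX; rewrite (schouten_anti (is_mv_of_fun f) hX) -signr_odd scale1r.
Qed.

Lemma schouten00 f g : schouten (of_fun n f) (of_fun n g) = 0.
Proof.
have := hamE (of_fun n f) g; rewrite /ham => ->; rewrite big1 // => i _.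
rewrite (rcontrE i (is_mv_of_fun f)) (lcontr_fun i (is_mv_of_fun f)).
by rewrite !scaler0.
Qed.

Lemma schouten11 X : is_mv 1 X -> schouten X X = 0.
Proof.
move=> hX; apply: mv1P; [exact: is_mv_schouten11 | exact: is_mv0 |] => i.
by rewrite schouten1_coef // subrr ffunE.
Qed.

Lemma mderivU m (i k : 'I_m) : ('X_i : {mpoly K[m]})^`M(k) = (i == k)%:R.
Proof.
rewrite mderivX mnm1E; case: eqP => [->|_]; last by rewrite scale0r.
by rewrite -[X in (X - _)%MM]add0m addmK mpolyX0 scale1r.
Qed.

Lemma schouten_partial i Q :
  schouten (partial K i) Q = dcoef i Q.
Proof.
have d0 k : dcoef k (partial K i : mvf K n) = 0.
  apply/ffunP => S; rewrite !ffunE.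
  by case: eqP => _; rewrite ?mderiv0 // -mpolyC1 mderivC.
rewrite /schouten (bigD1 i) //= big1 => [|j nj]; rewrite d0 wedge0l subr0.
  rewrite (contr1 i (is_mv_partial _)).2 wedge_funl /partial ffunE eqxx scale1r.
  by rewrite addr0.
rewrite (contr1 j (is_mv_partial _)).2 wedge_funl /partial ffunE.
by rewrite (inj_eq (@set1_inj _)) (negPf nj) scale0r.
Qed.

Lemma is_mv_ham P f : is_mv 2 P -> is_mv 1 (ham P f).
Proof. by move=> hP; exact: is_mv_schouten hP (is_mv_of_fun f). Qed.

Hypothesis two_neq0 : (2%:R : K) != 0.

Lemma mv_natmul_eq0 m Q : (m%:R : K) != 0 -> Q *+ m = 0 -> Q = 0.
Proof.
move=> nm e; have <- : ((m%:R : K)^-1)%:MP *: (Q *+ m) = Q.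
  by rewrite -scaler_nat scalerA -mpolyC_nat -mpolyCM mulVf // mpolyC1 scale1r.
by rewrite e scaler0.
Qed.

Lemma wedge11 X : is_mv 1 X -> wedge X X = 0.
Proof.
move=> hX; apply: (mv_natmul_eq0 two_neq0).
by rewrite mulr2n {1}(wedgeC hX hX) expr1 scaleN1r addNr.
Qed.

(** The bivector w = t P + V /\ W, with V = [P,t].  The field Z and the function
  a are parameters so that one computation covers both the case
  [P,W] = P, [W,t] = t and the case [P,W] = P + V /\ d, [W,t] = 0. *)
Section TwistedBivector.
Variables (P V W Z : mvf K n) (t a : {mpoly K[n]}).
Hypotheses (hP : is_mv 2 P) (hV : is_mv 1 V) (hW : is_mv 1 W).
Hypotheses (PP : schouten P P = 0) (Pt : schouten P (of_fun n t) = V).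
Hypotheses (PV : schouten P V = 0) (Vt : schouten V (of_fun n t) = 0).
Hypotheses (VW : schouten V W = 0) (Wt : schouten W (of_fun n t) = of_fun n a).
Hypothesis PW : schouten P W = P + wedge V Z.
Local Notation w := (t *: P + wedge V W).

Lemma is_mv_twist : is_mv 2 w.
Proof. by apply: is_mvD; [exact: is_mvZ | exact: is_mv_wedge hV hW]. Qed.

Lemma twist_fun : schouten w (of_fun n t) = (t + a) *: V.
Proof.
rewrite (schouten02C _ is_mv_twist) schoutenDr (schouten_scale _ _ (is_mv_of_fun t)).
rewrite schouten00 wedge0l add0r -(schouten02C _ hP) Pt.
rewrite (schouten_wedge1 _ (is_mv_of_fun t) hV) (schouten01C _ hV) Vt oppr0 wedge0l add0r.
by rewrite (schouten01C _ hW) Wt expr1 scaleN1r wedgeNr opprK wedge_funr scalerDl.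
Qed.

Lemma twist_ham : schouten w V = 0.
Proof.
rewrite (schouten21C hV is_mv_twist) schoutenDr (schouten_scale _ _ hV) Vt wedge0l add0r.
rewrite (schouten12C hV hP) PV oppr0 scaler0 add0r (schouten_wedge1 _ hV hV).
by rewrite VW schouten11 // wedge0l wedge0r scaler0 addr0 oppr0.
Qed.

Lemma twist_field : schouten w W = t *: (P + wedge V Z) - a *: P.
Proof.
rewrite (schouten21C hW is_mv_twist) schoutenDr (schouten_scale _ _ hW) Wt wedge_funl.
rewrite (schouten12C hW hP) PW (schouten_wedge1 _ hW hV).
rewrite (schouten11C hW hV) VW oppr0 wedge0l schouten11 // wedge0r scaler0 !addr0.
by rewrite opprD scalerN opprK addrC.
Qed.

(** The two contributions to [w,P] are V /\ P and - V /\ [P,W], and the term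
  V /\ Z of [P,W] is killed by V /\ V = 0. *)
Lemma twist_base : schouten w P = 0.
Proof.
rewrite (schouten22C is_mv_twist hP) schoutenDr (schouten_scale _ _ hP) Pt PP.
rewrite (schouten_wedge1 _ hP hV) PV PW scaler0 wedge0l addr0 add0r.
by rewrite wedgeDr wedgeA wedge11 // wedge0l addr0 -signr_odd scaleN1r addrN.
Qed.

(** By the Leibniz rule [w,w] = [w,t] P - V /\ [w,W], since w commutes with P and
  V.  Here [w,t] = (t + a) V and [w,W] = t (P + V /\ Z) - a P: the terms in t
  cancel and those in a add up. *)
Lemma twist_self : schouten w w = (a *: wedge V P) *+ 2.
Proof.
rewrite schoutenDr (schouten_scale _ _ is_mv_twist).
rewrite (schouten_wedge1 _ is_mv_twist hV) twist_fun twist_base twist_ham twist_field.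
rewrite scaler0 addr0 wedge0l add0r -signr_odd scaleN1r wedgeDr wedgeNr !wedgeZr wedgeDr.
rewrite wedgeA wedge11 // wedge0l addr0 wedgeZl scalerDl opprD opprK.
move: (t *: wedge V P) (a *: wedge V P) => x y.
by rewrite addrACA addrN add0r mulr2n.
Qed.

End TwistedBivector.

End BracketCalculus.

Arguments is_mv_partial {K n} i.
Arguments is_mv_euler {K n}.

(** * The Lie-Poisson bivector *)

Lemma sum_pairs_sym (V : zmodType) n (F : 'I_n -> 'I_n -> V) :
    (forall i j, F i j = F j i) -> (forall i, F i i = 0) ->
  \sum_i \sum_j F i j = (\sum_(i < n) \sum_(j < n | (i < j)%N) F i j) *+ 2.
Proof.
move=> Fsym F0; rewrite mulr2n [X in _ = _ + X](exchange_big_dep predT) //= -big_split.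
apply: eq_bigr => i _; rewrite (bigID (fun j : 'I_n => (i < j)%N)) /=; congr (_ + _).
rewrite (bigD1 i) ?ltnn //= F0 add0r; apply: eq_big => [j|j _]; last exact: Fsym.
by rewrite -leqNgt ltn_neqAle andbC.
Qed.

(** The hamiltonian field of [y].  It is sealed so that comparing two such fields
  compares their parameters [y], instead of unfolding the bracket down to the
  coefficients. *)
HB.lock Definition hamfield (K : fieldType) (L : vectType K) (br : L -> L -> L)
  n (b : n.-tuple L) (y : L) : mvf K n := ham (lie_poisson br b) (linfun_of b y).

Section LiePoissonIdentities.
Variables (K : fieldType) (L : vectType K) (br : L -> L -> L).
Hypothesis hbr : lie_bracket br.
Variables (n : nat) (b : n.-tuple L).
Hypothesis hb : basis_of fullv b.
Hypotheses (two_neq0 : (2%:R : K) != 0) (three_neq0 : (3%:R : K) != 0).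
Local Notation P := (lie_poisson br b).
Local Notation lf := (linfun_of b).
Local Notation V y := (hamfield br b y).

Let hP : is_mv 2 P := is_mv_lie_poisson br b.

Lemma hamfieldE y : V y = ham P (lf y).
Proof. by rewrite hamfield.unlock. Qed.

Lemma schouten_lie_poisson_linfun y : schouten P (of_fun n (lf y)) = V y.
Proof. by rewrite hamfieldE. Qed.

Lemma is_mv_hamfield y : is_mv 1 (V y).
Proof. by rewrite hamfieldE; exact: is_mv_ham. Qed.
Let hV := is_mv_hamfield.

Lemma coord_tnth i j : coord b j (tnth b i) = (i == j)%:R.
Proof. by rewrite (tnth_nth 0) coord_free // (basis_free hb). Qed.

Lemma vact_hamfield y z : vact (V y) (lf z) = lf (br z y).
Proof. by rewrite hamfieldE (lie_poisson_bracket hbr _ _ hb). Qed.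

Lemma hamfield_coef y k : V y [set k] = lf (br (tnth b k) y).
Proof.
rewrite -vact_hamfield /vact (bigD1 k) //= big1 => [|j nj].
  by rewrite mderiv_linfun coord_tnth eqxx mpolyC1 mulr1 addr0.
by rewrite mderiv_linfun coord_tnth eq_sym (negPf nj) mpolyC0 mulr0.
Qed.

Lemma hamfield_linfun y z : schouten (V y) (of_fun n (lf z)) = of_fun n (lf (br z y)).
Proof. by rewrite schouten_fun // vact_hamfield. Qed.

Lemma basis_expand w : w = \sum_i coord b i w *: tnth b i.
Proof.
rewrite {1}(coord_basis hb (memvf w)); apply: eq_bigr => i _.
by rewrite -tnth_nth.
Qed.

(** On the coordinate of [b_k] this is the Jacobi identity
  [[b_k,z],y] - [[b_k,y],z] = [b_k,[z,y]]. *)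
Lemma hamfield_schouten y z : schouten (V y) (V z) = V (br z y).
Proof.
apply: mv1P; [exact: is_mv_schouten11 (hV y) (hV z) | exact: hV | move=> k].
rewrite [LHS](schouten1_coef k (hV y) (hV z)).
rewrite !hamfield_coef !vact_hamfield.
rewrite -linfun_ofN -linfun_ofD; congr linfun_of.
case: (hbr) => _ _ _ /(_ (tnth b k) z y) /eqP.
have brNl u w : br (- u) w = - br u w by rewrite -scaleN1r (brZl hbr) scaleN1r.
rewrite (brC hbr y (br _ z)) (brC hbr z (br y _)) (brC hbr y (tnth b k)).
by rewrite brNl opprK subr_eq0 => /eqP <-; rewrite addrK.
Qed.

Local Notation v i := (V (tnth b i)).

Lemma hamfield_expand y : V y = \sum_i (coord b i y)%:MP *: v i.
Proof.
apply: mv1P; [exact: hV | | move=> k].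
  by apply: is_mv_sum => i _; exact: is_mvZ.
rewrite ext_sumE hamfield_coef {1}[y]basis_expand (br_sumr hbr) linfun_of_sum.
apply: eq_bigr => i _; rewrite (brZr hbr) linfun_ofZ -mul_mpolyC.
by rewrite ffunE hamfield_coef.
Qed.

Lemma rcontr_lie_poisson k : rcontr k P = v k.
Proof.
rewrite hamfieldE hamE (bigD1 k) //= big1 => [|j nj].
  by rewrite mderiv_linfun coord_tnth eqxx mpolyC1 scale1r addr0.
by rewrite mderiv_linfun coord_tnth eq_sym (negPf nj) mpolyC0 scale0r.
Qed.

(** Summing over all pairs of indices rather than over i < j makes the fields
  [v i] appear, at the price of the factor 2. *)
Lemma lie_poisson_double : P *+ 2 = \sum_i wedge (v i) (partial K i).
Proof.
rewrite -sum_pairs_sym => [|i j|i].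
- rewrite exchange_big; apply: eq_bigr => i _ /=.
  rewrite [in RHS](mv1E (hV _)) wedge_suml; apply: eq_bigr => j _.
  by rewrite wedgeZl hamfield_coef.
- rewrite (wedgeC (is_mv_partial i) (is_mv_partial j)) expr1 scaleN1r scalerN.
  by rewrite (brC hbr) linfun_ofN scaleNr opprK.
by rewrite (wedge11 two_neq0 (is_mv_partial _)) scaler0.
Qed.

Lemma hamfield_partial y i :
  schouten (V y) (partial K i) = - \sum_j (coord b i (br (tnth b j) y))%:MP *: partial K j.
Proof.
rewrite (schouten11C (hV y) (is_mv_partial _)) schouten_partial; congr (- _).
rewrite [LHS]mv1E; last exact: is_mv_dcoef.
by apply: eq_bigr => j _; rewrite dcoefE hamfield_coef mderiv_linfun.
Qed.

(** With e_i = d/dx_i, in the bracket of V_y with 2 P = sum_i v_i /\ e_i the first factors give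
  sum_i V_[b_i,y] /\ e_i, and the second ones, after exchanging the sums and
  by linearity of V_y in y, the opposite of it. *)
Lemma lie_poisson_invariant y : schouten (V y) P = 0.
Proof.
apply: (mv_natmul_eq0 two_neq0); rewrite -schoutenMnr lie_poisson_double schouten_sumr.
rewrite (eq_bigr (fun i => wedge (V (br (tnth b i) y)) (partial K i) -
   \sum_j wedge ((coord b i (br (tnth b j) y))%:MP *: v i) (partial K j))); last first.
  move=> i _; rewrite (schouten_wedge1 _ (hV y) (hV _)) hamfield_schouten -signr_odd scale1r.
  rewrite hamfield_partial wedgeNr wedge_sumr; congr (_ - _).
  by apply: eq_bigr => j _; rewrite wedgeZl wedgeZr.
rewrite sumrB exchange_big -sumrB big1 // => i _ /=.
by rewrite -wedge_suml -hamfield_expand subrr.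
Qed.

(** With A = sum_k v_k /\ dP/dx_k, the definition of the bracket gives
  [P,P] = 2 A.  Expanding the second P of [P,P] as half of
  sum_k v_k /\ e_k, where P commutes with v_k by invariance and
  [P,e_k] = - dP/dx_k, gives 2 [P,P] = A.  Hence 3 [P,P] = 0. *)
Lemma lie_poisson_poisson : schouten P P = 0.
Proof.
pose A := \sum_k wedge (v k) (dcoef k P).
have PA : schouten P P = A *+ 2.
  rewrite mulr2n -big_split; apply: eq_bigr => k _ /=.
  have -> : lcontr k P = - v k.
    by rewrite -rcontr_lie_poisson (rcontrE k hP) -signr_odd expr1 scaleN1r opprK.
  rewrite rcontr_lie_poisson wedgeNr opprK; congr (_ + _).
  by rewrite (wedgeC (is_mv_dcoef k hP) (hV _)) -signr_odd scale1r.
have AP : schouten P P *+ 2 = A.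
  rewrite -schoutenMnr lie_poisson_double schouten_sumr; apply: eq_bigr => k _.
  rewrite (schouten_wedge1 _ hP (hV _)) (schouten21C (hV _) hP) lie_poisson_invariant.
  rewrite oppr0 wedge0l add0r -signr_odd expr1 scaleN1r.
  by rewrite (schouten21C (is_mv_partial _) hP) schouten_partial wedgeNr opprK.
apply: (mv_natmul_eq0 three_neq0).
have : schouten P P *+ 4 = schouten P P by rewrite (mulrnA _ 2 2) AP -PA.
by rewrite mulrS => /(canRL (addKr _)); rewrite addNr.
Qed.

Lemma euler_linfun y : schouten (euler K n) (of_fun n (lf y)) = of_fun n (lf y).
Proof.
rewrite schouten_fun ?vact_euler; last exact: is_mv_euler.
congr of_fun; apply: eq_bigr => i _.
by rewrite mderiv_linfun mulrC mul_mpolyC.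
Qed.

Lemma euler_hamfield y : schouten (euler K n) (V y) = 0.
Proof.
apply: mv1P; [exact: is_mv_schouten11 is_mv_euler _ | exact: is_mv0 | move=> k].
rewrite schouten1_coef //; last exact: is_mv_euler.
rewrite euler_coef hamfield_coef [RHS]ffunE vact_euler /vact.
rewrite [X in _ - X](bigD1 k) //= [X in _ - (_ + X)]big1 => [|j nj]; last first.
  by rewrite mderivU eq_sym (negPf nj) mulr0.
rewrite mderivU eqxx mulr1 addr0 hamfield_coef; apply/eqP; rewrite subr_eq0; apply/eqP.
by apply: eq_bigr => i _; rewrite mderiv_linfun mulrC mul_mpolyC.
Qed.

Lemma euler_partial i : schouten (euler K n) (partial K i) = - partial K i.
Proof.
rewrite (schouten11C is_mv_euler (is_mv_partial _)) schouten_partial; congr (- _).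
apply: mv1P; [exact: is_mv_dcoef is_mv_euler | exact: is_mv_partial |] => k.
by rewrite dcoefE euler_coef ffunE mderivU (inj_eq (@set1_inj _)).
Qed.

(** Linear coefficients make E commute with the fields v_i, while
  [E,e_i] = - e_i; so each summand of [lie_poisson_double] has weight -1. *)
Lemma schouten_lie_poisson_euler : schouten P (euler K n) = P.
Proof.
rewrite (schouten21C is_mv_euler hP).
have nat2 (Q T : mvf K n) : Q *+ 2 = T *+ 2 -> Q = T.
  move/eqP; rewrite -subr_eq0 -mulrnBl => /eqP /(mv_natmul_eq0 two_neq0)/eqP.
  by rewrite subr_eq0 => /eqP.
apply: nat2; rewrite mulNrn -schoutenMnr lie_poisson_double schouten_sumr -sumrN.
apply: eq_bigr => i _; rewrite (schouten_wedge1 _ is_mv_euler (hV _)) euler_hamfield.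
by rewrite wedge0l add0r -signr_odd scale1r euler_partial wedgeNr opprK.
Qed.

Lemma ham_half_square y : ham P (2^-1 *: lf y ^+ 2) = lf y *: V y.
Proof.
rewrite hamfieldE !hamE scaler_sumr; apply: eq_bigr => k _.
rewrite scalerA; congr (_ *: _).
rewrite mderivZ expr2 mderivM [X in X + _]mulrC -mulr2n.
by rewrite -scalerMnr scalerMnl -mulr_natr mulVf // scale1r.
Qed.

Lemma schouten_quadratic_field y :
  schouten (lf y *: euler K n) P = - (lf y *: P + wedge (V y) (euler K n)).
Proof.
rewrite (schouten12C (is_mvZ _ is_mv_euler) hP) (schouten_scale _ _ hP).
by rewrite schouten_lie_poisson_euler addrC hamfieldE.
Qed.

End LiePoissonIdentities.

(** * Extension by one coordinate *)

Section LiftFunctions.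
Variables (K : fieldType) (n : nat).
Implicit Types (f g : {mpoly K[n]}) (i : 'I_n).

Lemma lift_funD f g : lift_fun (f + g) = lift_fun f + lift_fun g.
Proof. exact: comp_mpolyD. Qed.
Lemma lift_funM f g : lift_fun (f * g) = lift_fun f * lift_fun g.
Proof. exact: rmorphM. Qed.
Lemma lift_fun0 : lift_fun (0 : {mpoly K[n]}) = 0.
Proof. exact: comp_mpoly0. Qed.
Lemma lift_funC (c : K) : lift_fun (c%:MP : {mpoly K[n]}) = c%:MP.
Proof. exact: comp_mpolyC. Qed.
Lemma lift_fun_sign k : lift_fun ((-1) ^+ k : {mpoly K[n]}) = (-1) ^+ k.
Proof. exact: rmorph_sign. Qed.
Lemma lift_funX i : lift_fun ('X_i : {mpoly K[n]}) = 'X_(lift ord0 i).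
Proof. by rewrite /lift_fun comp_mpolyXU -tnth_nth tnth_mktuple. Qed.

Lemma mpoly_alg_ind (Pr : {mpoly K[n]} -> Prop) :
    (forall c, Pr c%:MP) -> (forall i, Pr 'X_i) ->
    (forall f g, Pr f -> Pr g -> Pr (f + g)) ->
    (forall f g, Pr f -> Pr g -> Pr (f * g)) -> forall f, Pr f.
Proof.
move=> hC hX hD hM f; rewrite (mpolyE f).
apply: (big_ind Pr) => [| |m _]; [by rewrite -mpolyC0 | exact: hD |].
rewrite -mul_mpolyC; apply: (hM) => //; rewrite mpolyXE_id.
apply: (big_ind Pr) => [| |i _]; [by rewrite -mpolyC1 | exact: hM |].
elim: (m i) => [|k IH]; first by rewrite expr0 -mpolyC1.
by rewrite exprS; apply: hM.
Qed.

Lemma mderiv_lift_fun i f : (lift_fun f)^`M(lift ord0 i) = lift_fun f^`M(i).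
Proof.
elim/mpoly_alg_ind: f => [c|j|f g hf hg|f g hf hg].
- by rewrite lift_funC !mderivC lift_fun0.
- by rewrite lift_funX !mderivU (inj_eq lift_inj) -!mpolyC_nat lift_funC.
- by rewrite lift_funD !mderivD lift_funD hf hg.
- by rewrite lift_funM !mderivM lift_funD !lift_funM hf hg.
Qed.

Lemma mderiv0_lift_fun f : (lift_fun f)^`M(ord0) = 0.
Proof.
elim/mpoly_alg_ind: f => [c|j|f g hf hg|f g hf hg].
- by rewrite lift_funC mderivC.
- by rewrite lift_funX mderivU.
- by rewrite lift_funD mderivD hf hg addr0.
- by rewrite lift_funM mderivM hf hg mul0r mulr0 addr0.
Qed.

Lemma lift_fun_homog d f : f \is d.-homog -> lift_fun f \is d.-homog.
Proof.
move=> hf; rewrite /lift_fun comp_mpolyEX big_seq; apply: rpred_sum => m hm.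
apply: rpredZ; rewrite -(dhomog_mf hf hm) comp_mpolyX /= mdegE.
apply: (big_rec2 (fun p k => p \is k.-homog)) => [|i p k _ hp]; first exact: dhomog1.
apply: dhomogM hp; rewrite -[X in X.-homog]mul1n; apply: dhomogMn.
by rewrite tnth_mktuple dhomogX /= mdeg1.
Qed.

Lemma lift_fun_root f (p : 'I_n.+1 -> K) :
  f \is 1.-homog -> (forall i, p (lift ord0 i) = 0) -> (lift_fun f).@[p] = 0.
Proof.
move=> hf hp; rewrite /lift_fun comp_mpoly_meval mevalE big_seq big1 // => m hm.
have : mdeg m = 1%N := dhomog_mf hf hm.
move/eqP/mdeg1P => [i /eqP ->].
rewrite (bigD1 i) //= mnm1E eqxx expr1 tnth_mktuple mevalXU hp.
by rewrite mul0r mulr0.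
Qed.

End LiftFunctions.

Section LiftMultivectors.
Variables (K : fieldType) (n : nat).
Implicit Types (P Q : mvf K n) (A B : {set 'I_n}) (f : {mpoly K[n]}) (i : 'I_n).
Local Notation up := (lift ord0).
Local Notation upset A := [set up i | i in A].

Lemma preim_upset A : up @^-1: (upset A) = A.
Proof. by apply/setP => i; rewrite inE mem_imset //; exact: lift_inj. Qed.

Lemma ord0_upset A : (ord0 \in upset A) = false.
Proof. by apply/negP => /imsetP [i _ /eqP]; rewrite eq_liftF. Qed.

Lemma upset_preim (S : {set 'I_n.+1}) : ord0 \notin S -> upset (up @^-1: S) = S.
Proof.
move=> S0; apply/setP => j; case: (unliftP ord0 j) => [i ->|->].
  by rewrite mem_imset ?inE //; exact: lift_inj.
by rewrite ord0_upset (negPf S0).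
Qed.

Lemma lift_mvE P A : lift_mv P (upset A) = lift_fun (P A).
Proof. by rewrite ffunE ord0_upset preim_upset. Qed.

Lemma lift_mv_ord0 P (S : {set 'I_n.+1}) : ord0 \in S -> lift_mv P S = 0.
Proof. by rewrite ffunE => ->. Qed.

Lemma lift_mvP P (Q : mvf K n.+1) :
    (forall A, Q (upset A) = lift_fun (P A)) ->
    (forall S : {set 'I_n.+1}, ord0 \in S -> Q S = 0) -> Q = lift_mv P.
Proof.
move=> hQ Q0; apply/ffunP => S; have [S0|S0] := boolP (ord0 \in S).
  by rewrite Q0 // lift_mv_ord0.
by rewrite -(upset_preim S0) hQ lift_mvE.
Qed.

Lemma ninv_upset A B : ninv (upset A) (upset B) = ninv A B.
Proof.
rewrite /ninv big_imset => [|i j _ _ /lift_inj //]; apply: eq_bigr => a _ /=.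
rewrite big_imset => [|i j _ _ /lift_inj //]; apply: eq_bigr => c _ /=.
by rewrite /bump !leq0n !add1n ltnS.
Qed.

Lemma lift_mvD P Q : lift_mv (P + Q) = lift_mv P + lift_mv Q.
Proof.
apply/esym/lift_mvP => [A|S S0]; first by rewrite !ffunE !ord0_upset !preim_upset lift_funD.
by rewrite ffunE !lift_mv_ord0 // addr0.
Qed.

Lemma lift_mvZ f P : lift_mv (f *: P) = lift_fun f *: lift_mv P.
Proof.
apply/esym/lift_mvP => [A|S S0].
  by rewrite scaleE lift_mvE scaleE lift_funM.
by rewrite scaleE lift_mv_ord0 // mulr0.
Qed.

Lemma lift_mv0 : lift_mv (0 : mvf K n) = 0.
Proof. by apply: (addIr (lift_mv 0)); rewrite -lift_mvD !add0r. Qed.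

Lemma lift_mvN P : lift_mv (- P) = - lift_mv P.
Proof. by apply: (addIr (lift_mv P)); rewrite -lift_mvD !addNr lift_mv0. Qed.

Lemma lift_mv_sum I (r : seq I) (p : pred I) (F : I -> mvf K n) :
  lift_mv (\sum_(k <- r | p k) F k) = \sum_(k <- r | p k) lift_mv (F k).
Proof. exact: (big_morph _ lift_mvD lift_mv0). Qed.

Lemma lift_of_fun f : lift_mv (of_fun n f) = of_fun n.+1 (lift_fun f).
Proof.
apply/esym/lift_mvP => [A|S S0]; rewrite !of_funE.
  rewrite imset_eq0; case: eqP => // _; exact/esym/lift_fun0.
by case: eqP => // eS; rewrite eS inE in S0.
Qed.

Lemma lift_ebase A : lift_mv (ebase _ A : mvf K n) = ebase _ (upset A).
Proof.
apply/esym/lift_mvP => [B|S S0]; rewrite !ffunE.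
  by rewrite (inj_eq (imset_inj lift_inj)) -!mpolyC_nat lift_funC.
by case: eqP => // eS; rewrite eS ord0_upset in S0.
Qed.

(** By bilinearity it suffices to treat basis elements, where the sign is
  unchanged because [up] is increasing. *)
Lemma lift_wedge P Q : lift_mv (wedge P Q) = wedge (lift_mv P) (lift_mv Q).
Proof.
rewrite (ebaseE P) (lift_mv_sum _ _ (fun A => _)) !wedge_suml lift_mv_sum.
apply: eq_bigr => A _; rewrite (lift_mvZ (P A)) !wedgeZl lift_mvZ; congr (_ *: _).
rewrite (ebaseE Q) (lift_mv_sum _ _ (fun A => _)) !wedge_sumr lift_mv_sum.
apply: eq_bigr => B _; rewrite (lift_mvZ (Q B)) !wedgeZr lift_mvZ; congr (_ *: _).
rewrite !lift_ebase !wedge_ebase ninv_upset -!setI_eq0 -imsetI; last first.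
  by move=> i j _ _; exact: lift_inj.
rewrite imset_eq0; case: eqP => _; last exact: lift_mv0.
by rewrite lift_mvZ lift_fun_sign lift_ebase imsetU.
Qed.

Lemma lift_lcontr i P : lcontr (up i) (lift_mv P) = lift_mv (lcontr i P).
Proof.
apply: lift_mvP => [A|S S0]; last first.
  by rewrite ffunE lift_mv_ord0 ?mulr0 ?if_same // inE S0 orbT.
rewrite ffunE [lcontr i P A]ffunE mem_imset; last exact: lift_inj.
case: ifP => _; first by rewrite lift_fun0.
by rewrite lift_funM lift_fun_sign -imset_set1 ninv_upset -imsetU lift_mvE.
Qed.

Lemma lift_rcontr i P : rcontr (up i) (lift_mv P) = lift_mv (rcontr i P).
Proof.
apply: lift_mvP => [A|S S0]; last first.
  by rewrite ffunE lift_mv_ord0 ?mulr0 ?if_same // inE S0 orbT.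
rewrite ffunE [rcontr i P A]ffunE mem_imset; last exact: lift_inj.
case: ifP => _; first by rewrite lift_fun0.
by rewrite lift_funM lift_fun_sign -imset_set1 ninv_upset -imsetU lift_mvE.
Qed.

Lemma rcontr0_lift P : rcontr ord0 (lift_mv P) = 0.
Proof. by apply/ffunP => S; rewrite !ffunE !inE eqxx /= mulr0 if_same. Qed.

Lemma lcontr0_lift P : lcontr ord0 (lift_mv P) = 0.
Proof. by apply/ffunP => S; rewrite !ffunE !inE eqxx /= mulr0 if_same. Qed.

Lemma lift_dcoef i P : dcoef (up i) (lift_mv P) = lift_mv (dcoef i P).
Proof.
apply: lift_mvP => [A|S S0]; first by rewrite !dcoefE lift_mvE mderiv_lift_fun.
by rewrite dcoefE lift_mv_ord0 // mderiv0.
Qed.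

Lemma dcoef0_lift P : dcoef ord0 (lift_mv P) = 0.
Proof.
by apply/ffunP => S; rewrite !ffunE; case: ifP; rewrite ?mderiv0 ?mderiv0_lift_fun.
Qed.

(** The additional index 0 contributes nothing, a lifted field having no
  component along [d/dx_0]. *)
Lemma lift_schouten P Q : lift_mv (schouten P Q) = schouten (lift_mv P) (lift_mv Q).
Proof.
rewrite /schouten big_ord_recl rcontr0_lift lcontr0_lift wedge0l wedge0r subr0 add0r lift_mv_sum.
apply: eq_bigr => i _; rewrite lift_mvD lift_mvN !lift_wedge.
by rewrite -lift_rcontr -lift_lcontr -!lift_dcoef.
Qed.

Lemma is_mv_lift p P : is_mv p P -> is_mv p (lift_mv P).
Proof.
move=> hP S nS; have [S0|S0] := boolP (ord0 \in S); first by rewrite lift_mv_ord0.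
rewrite -(upset_preim S0) lift_mvE hP ?lift_fun0 //.
by rewrite -(card_imset _ (@lift_inj _ ord0)) upset_preim.
Qed.

Lemma ham_lift_X0 P : schouten (lift_mv P) (of_fun n.+1 'X_ord0) = 0.
Proof.
rewrite -/(ham _ _) hamE big1 // => k _; case: (unliftP ord0 k) => [i ->|->].
  by rewrite mderivU scale0r.
by rewrite rcontr0_lift scaler0.
Qed.

End LiftMultivectors.

(** * Homogeneity of the coefficients *)

Definition coef_homog (K : fieldType) n (d : nat) (P : mvf K n) :=
  forall S, P S \is d.-homog.

Section CoefHomog.
Variables (K : fieldType) (n : nat).
Implicit Types (P Q : mvf K n) (f : {mpoly K[n]}).

Lemma coef_homogD d P Q : coef_homog d P -> coef_homog d Q -> coef_homog d (P + Q).
Proof. by move=> hP hQ S; rewrite ffunE; apply: rpredD. Qed.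

Lemma coef_homogN d P : coef_homog d P -> coef_homog d (- P).
Proof. by move=> hP S; rewrite ffunE rpredN. Qed.

Lemma coef_homog_sum d I (r : seq I) (p : pred I) (F : I -> mvf K n) :
  (forall i, p i -> coef_homog d (F i)) -> coef_homog d (\sum_(i <- r | p i) F i).
Proof. by move=> hF S; rewrite ext_sumE; apply: rpred_sum => i pi; exact: hF. Qed.

Lemma coef_homogZ d e f P : f \is d.-homog -> coef_homog e P -> coef_homog (d + e) (f *: P).
Proof. by move=> hf hP S; rewrite scaleE; exact: dhomogM. Qed.

Lemma coef_homog_wedge d e P Q :
  coef_homog d P -> coef_homog e Q -> coef_homog (d + e) (wedge P Q).
Proof.
move=> hP hQ S; rewrite ffunE; apply: rpred_sum => A _.
by rewrite rpredMsign; exact: dhomogM.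
Qed.

Lemma coef_homog_partial i : coef_homog 0 (partial K (i : 'I_n)).
Proof.
by move=> S; rewrite ffunE; case: eqP => _; rewrite ?dhomog0 // mulr1n dhomog1.
Qed.

Lemma coef_homog_euler : coef_homog 1 (euler K n).
Proof.
apply: coef_homog_sum => i _; apply: (coef_homogZ (d := 1) (e := 0)).
  by rewrite dhomogX /= mdeg1.
exact: coef_homog_partial.
Qed.

Lemma coef_homog_lift d P : coef_homog d P -> coef_homog d (lift_mv P).
Proof.
by move=> hP S; rewrite ffunE; case: ifP => _; [exact: dhomog0 | exact: lift_fun_homog].
Qed.

Lemma lift_mv_root P (p : 'I_n.+1 -> K) S :
  coef_homog 1 P -> (forall i, p (lift ord0 i) = 0) -> (lift_mv P S).@[p] = 0.
Proof.
by move=> hP hp; rewrite ffunE; case: ifP => _; [exact: meval0 | exact: lift_fun_root].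
Qed.

Lemma wedge_root P Q (p : 'I_n -> K) S :
  (forall A, (P A).@[p] = 0) -> (wedge P Q S).@[p] = 0.
Proof.
move=> hP; rewrite ffunE raddf_sum big1 // => A _ /=.
by rewrite !mevalM hP mul0r mulr0.
Qed.

End CoefHomog.

Section LieHomog.
Variables (K : fieldType) (L : vectType K) (br : L -> L -> L).
Hypothesis hbr : lie_bracket br.
Variables (n : nat) (b : n.-tuple L).
Hypothesis hb : basis_of fullv b.

Lemma linfun_homog y : linfun_of b y \is 1.-homog.
Proof. by apply: rpred_sum => i _; apply: rpredZ; rewrite dhomogX /= mdeg1. Qed.

Lemma lie_poisson_homog : coef_homog 1 (lie_poisson br b).
Proof.
apply: coef_homog_sum => i _; apply: coef_homog_sum => j _.
apply: (coef_homogZ (d := 1) (e := 0 + 0)); first exact: linfun_homog.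
by apply: coef_homog_wedge; exact: coef_homog_partial.
Qed.

Lemma hamfield_homog y : coef_homog 1 (hamfield br b y).
Proof.
rewrite (mv1E (is_mv_hamfield br b y)).
apply: coef_homog_sum => i _; apply: (coef_homogZ (d := 1) (e := 0)).
  by rewrite (hamfield_coef hbr hb); exact: linfun_homog.
exact: coef_homog_partial.
Qed.

End LieHomog.

(** * The bivector on the extended space *)

Section Extension.
Variables (K : fieldType) (s : vectType K) (br : s -> s -> s).
Hypothesis hbr : lie_bracket br.
Variables (n : nat) (b : n.-tuple s).
Hypothesis hb : basis_of fullv b.
Hypotheses (two_neq0 : (2%:R : K) != 0) (three_neq0 : (3%:R : K) != 0).
Variable x : s.
Local Notation P := (lie_poisson br b).
Local Notation l := (linfun_of b x).
Local Notation V := (hamfield br b x).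
Local Notation E := (euler K n).
Local Notation lP := (lift_mv P).
Local Notation ll := (lift_fun l).
Local Notation lV := (lift_mv V).
Local Notation lE := (lift_mv E).
Local Notation X0 := ('X_ord0 : {mpoly K[n.+1]}).
Local Notation d0 := (partial K (ord0 : 'I_n.+1)).
Local Notation t := (ll - X0).
Local Notation W := (lE + ll *: d0).
Local Notation pi2 := (- (t *: lP + wedge lV W)).

Let hP : is_mv 2 P := is_mv_lie_poisson br b.
Let hV : is_mv 1 V := is_mv_hamfield br b x.
Let hW : is_mv 1 W :=
  is_mvD (is_mv_lift is_mv_euler) (is_mvZ ll (is_mv_partial ord0)).

Let of_funB (f g : {mpoly K[n.+1]}) :
  of_fun n.+1 (f - g) = of_fun n.+1 f - of_fun n.+1 g.
Proof. by apply/ffunP => S; rewrite !ffunE; case: eqP => _; rewrite ?subr0. Qed.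

Let partial0_lift (Q : mvf K n) p : is_mv p Q -> schouten (lift_mv Q) d0 = 0.
Proof.
move=> hQ; rewrite (schouten_anti (is_mv_lift hQ) (is_mv_partial _)) schouten_partial.
by rewrite dcoef0_lift scaler0 oppr0.
Qed.

Let lift_t (Q : mvf K n) : schouten (lift_mv Q) (of_fun n.+1 t) =
  lift_mv (schouten Q (of_fun n l)).
Proof. by rewrite of_funB schoutenDr schoutenNr ham_lift_X0 subr0 lift_schouten lift_of_fun. Qed.

Let Vl : schouten V (of_fun n l) = 0.
Proof.
rewrite (hamfield_linfun hbr hb); case: hbr => _ _ -> _.
by rewrite linfun_of0; apply/ffunP => S; rewrite !ffunE if_same.
Qed.

Let PV : schouten P V = 0.
Proof. by rewrite (schouten21C hV hP) (lie_poisson_invariant hbr hb) ?oppr0. Qed.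

Let VE : schouten V E = 0.
Proof. by rewrite (schouten11C hV is_mv_euler) (euler_hamfield hbr hb) oppr0. Qed.

Lemma ext_VW : schouten lV W = 0.
Proof.
rewrite schoutenDr -lift_schouten VE lift_mv0 add0r (schouten_scale _ _ (is_mv_lift hV)).
by rewrite -lift_of_fun -lift_schouten Vl lift_mv0 wedge0l (partial0_lift hV) scaler0 addr0.
Qed.

(** [E(t) = l] is compensated by the component of [W] along [d/dx_0], since
  [dt/dx_0 = -1]. *)
Lemma ext_Wt : schouten W (of_fun n.+1 t) = 0.
Proof.
rewrite schoutenDl lift_t (euler_linfun _ x) -/(ham _ _) hamE.
rewrite (eq_bigr (fun k => ll *: (t^`M(k) *: rcontr k d0))); last first.
  by move=> k _; rewrite rcontrZ !scalerA mulrC.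
rewrite -scaler_sumr -hamE /ham schouten_partial dcoef_of_fun.
rewrite mderivB mderiv0_lift_fun mderivU eqxx sub0r.
rewrite lift_of_fun; apply/ffunP => S; rewrite !ffunE /GRing.scale /=.
by case: eqP => _; rewrite ?mulr0 ?addr0 // mulrN1 addrN.
Qed.

Lemma ext_PW : schouten lP W = lP + wedge lV d0.
Proof.
rewrite schoutenDr -lift_schouten (schouten_lie_poisson_euler hbr hb) //.
rewrite (schouten_scale _ _ (is_mv_lift hP)) -lift_of_fun -lift_schouten.
by rewrite (partial0_lift hP) scaler0 addr0 schouten_lie_poisson_linfun.
Qed.

Lemma ext_twist_self : schouten (t *: lP + wedge lV W) (t *: lP + wedge lV W) = 0.
Proof.
rewrite (@twist_self _ _ two_neq0 lP lV W d0 t 0 (is_mv_lift hP) (is_mv_lift hV) hW).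
- by rewrite scale0r mul0rn.
- by rewrite -lift_schouten (lie_poisson_poisson hbr hb) // lift_mv0.
- by rewrite lift_t schouten_lie_poisson_linfun.
- by rewrite -lift_schouten PV lift_mv0.
- by rewrite lift_t Vl lift_mv0.
- exact: ext_VW.
- rewrite ext_Wt; apply/ffunP => S; rewrite !ffunE.
  by rewrite if_same.
exact: ext_PW.
Qed.

Lemma ext_as_twist :
  schouten (lift_mv (l *: E)) lP - wedge (lift_mv (ham P (2^-1 *: l ^+ 2))) d0 + X0 *: lP
  = pi2.
Proof.
rewrite -lift_schouten (schouten_quadratic_field hbr hb) //.
rewrite (ham_half_square br b two_neq0 x).
rewrite lift_mvN lift_mvD !lift_mvZ lift_wedge wedgeZl wedgeDr wedgeZr.
rewrite scalerBl.
move: (ll *: lP) (X0 *: lP) (wedge lV lE) (ll *: wedge lV d0) => A1 A2 A3 A4.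
by rewrite !opprD opprK -!addrA; congr (_ + _); rewrite addrA addrC.
Qed.

Lemma ext_expanded :
  pi2 =
  (X0 - ll) *: lP - wedge (lift_mv (ham P l)) (lE + ll *: d0).
Proof. by rewrite -hamfieldE opprD -scaleNr opprB. Qed.

Lemma ext_quadratic : quadratic pi2.
Proof.
have hlh : ll \is 1.-homog by apply: lift_fun_homog; exact: linfun_homog.
apply: coef_homogN; apply: coef_homogD.
  apply: (coef_homogZ (d := 1) (e := 1)).
    by apply: rpredB => //; rewrite dhomogX /= mdeg1.
  exact/coef_homog_lift/lie_poisson_homog.
apply: (coef_homog_wedge (d := 1) (e := 1)).
  exact/coef_homog_lift/(hamfield_homog hbr hb).
apply: coef_homogD; first exact/coef_homog_lift/coef_homog_euler.
by apply: (coef_homogZ (d := 1) (e := 0)) => //; exact: coef_homog_partial.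
Qed.

Lemma ext_poisson : poisson pi2.
Proof.
split; first exact: is_mvN (is_mv_twist _ (is_mv_lift hP) (is_mv_lift hV) hW).
by rewrite schoutenNl schoutenNr ext_twist_self !oppr0.
Qed.

Lemma ext_d0 : schouten d0 pi2 = lP.
Proof.
have d0t : schouten d0 (of_fun n.+1 t) = - of_fun n.+1 1.
  rewrite schouten_partial dcoef_of_fun mderivB mderiv0_lift_fun mderivU eqxx sub0r.
  by apply/ffunP => S; rewrite !ffunE; case: eqP => _; rewrite ?oppr0.
rewrite schoutenNr schoutenDr (schouten_scale _ _ (is_mv_partial _)) d0t wedgeNl wedge_funl.
rewrite (schouten_wedge1 _ (is_mv_partial _) (is_mv_lift hV)) !schouten_partial.
have -> : dcoef ord0 W = 0.
  rewrite -schouten_partial schoutenDr (schouten_scale _ _ (is_mv_partial _)).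
  rewrite -lift_of_fun !schouten_partial !dcoef0_lift wedge0l !add0r.
  by rewrite -schouten_partial (schouten11 (is_mv_partial _)) scaler0.
by rewrite !dcoef0_lift wedge0l wedge0r !scaler0 !addr0 scale1r opprK.
Qed.

Lemma ext_root (p : 'I_n.+1 -> K) S : (forall i, p (lift ord0 i) = 0) ->
  (pi2 S).@[p] = 0.
Proof.
move=> hp; rewrite ffunE mevalN ffunE mevalD scaleE mevalM.
rewrite (lift_mv_root _ (lie_poisson_homog br b) hp) mulr0 add0r wedge_root ?oppr0 // => A.
by rewrite (lift_mv_root _ (hamfield_homog hbr hb x) hp).
Qed.

Lemma ext_centrally_linearizable (c : K) : c != 0 ->
  centrally_linearizable br b c pi2.
Proof.
move=> hc.
(* The coordinate x_0 is the vector (0, c), so the point with x_0 = 1 on the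
   dual line takes the value 1 at (0, c). *)
pose a : 'Hom((s * K^o)%type, K^o) := linfun (GRing.scale c^-1 \o snd).
have aE u : a u = c^-1 * u.2 by rewrite lfunE.
have a0 : a (tnth (sum_coords b c) ord0) = 1.
  by rewrite aE (tnth_nth (0, c)) /= mulVf.
have aS i : a (tnth (sum_coords b c) (lift ord0 i)) = 0.
  by rewrite aE (tnth_nth (0, c)) /= (nth_map 0) /= ?mulr0 // size_tuple; exact: ltn_ord.
exists a; split.
- by move=> y; rewrite aE mulr0.
- apply/eqP => a_0; have := a0; rewrite a_0 zero_lfunE => /esym/eqP.
  by rewrite oner_eq0.
- by move=> S; apply: ext_root => i.
rewrite big_ord_recl a0 mpolyC1 scale1r big1 ?addr0 => [|i _]; first exact: ext_d0.
by rewrite aS mpolyC0 scale0r.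
Qed.

(** On the dual of [s] itself: here [t] and [a] of [twist_self] are
  both [l], and [Z] is zero. *)
Lemma quadratic_self :
  let pi := schouten (l *: E) P in
  schouten pi pi = wedge (ham P (2^-1 *: l ^+ 2)) P *+ 2 /\
  schouten pi (ham P (2^-1 *: l ^+ 2)) = 0.
Proof.
move=> pi; have -> : pi = - (l *: P + wedge V E).
  by rewrite /pi (schouten_quadratic_field hbr hb).
rewrite (ham_half_square br b two_neq0 x) wedgeZl.
have PP : schouten P P = 0 by apply: (lie_poisson_poisson hbr hb).
have Pl := schouten_lie_poisson_linfun br b x.
have El : schouten E (of_fun n l) = of_fun n l := euler_linfun b x.
have PE : schouten P E = P + wedge V 0.
  by rewrite wedge0r addr0 (schouten_lie_poisson_euler hbr hb).
rewrite !schoutenNl schoutenNr opprK; split.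
  exact: (twist_self two_neq0 hP hV is_mv_euler PP Pl PV Vl VE El PE).
have hw := is_mv_twist l hP hV is_mv_euler.
rewrite (schouten_scale _ _ hw) (twist_fun hP hV is_mv_euler Pl Vl El).
rewrite (twist_ham hP hV is_mv_euler PV Vl VE).
by rewrite wedgeZl (wedge11 two_neq0 hV) !scaler0 addr0 oppr0.
Qed.

End Extension.

Theorem theorem4p1 (R : realType) (K : fieldType)
    (hK : K = R :> fieldType \/ K = (R[i] : fieldType))
    (s : vectType K) (br : s -> s -> s) (hbr : lie_bracket br)
    (n : nat) (b : n.-tuple s) (hb : basis_of fullv b)
    (c : K) (hc : c != 0) (x : s) :
  let pi1 := lie_poisson br b in
  let X := linfun_of b x *: euler K n in
  let q := 2^-1 *: linfun_of b x ^+ 2 in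
  let pi := schouten X pi1 in
  [/\ schouten pi pi = wedge (ham pi1 q) pi1 *+ 2,
      schouten pi (ham pi1 q) = 0
    & semisimple br ->
      let x0 : {mpoly K[n.+1]} := 'X_ord0 in
      let d0 := partial K (ord0 : 'I_n.+1) in
      let lx := lift_fun (linfun_of b x) in
      let pi2 := schouten (lift_mv X) (lift_mv pi1)
                 - wedge (lift_mv (ham pi1 q)) d0 + x0 *: lift_mv pi1 in
      [/\ pi2 = (x0 - lx) *: lift_mv pi1
                - wedge (lift_mv (ham pi1 (linfun_of b x)))
                        (lift_mv (euler K n) + lx *: d0),
          quadratic pi2, poisson pi2
        & centrally_linearizable br b c pi2]].
Proof.
move=> pi1 X q pi.
have char0 m : (m.+1%:R : K) != 0.
  by case: hK => ->; rewrite Num.Theory.pnatr_eq0.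
have [pipi piq] := quadratic_self hbr hb (char0 1%N) (char0 2%N) x.
split=> // _ x0 d0 lx pi2.
have -> : pi2 = _ := ext_as_twist hbr hb (char0 1%N) x.
split.
- exact: ext_expanded.
- exact: ext_quadratic.
- exact: (ext_poisson hbr hb (char0 1%N) (char0 2%N)).
- exact: ext_centrally_linearizable.
Qed.
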